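(* Let $\alpha\in\mathbb{R}\setminus\pi\mathbb{Z}$, let $k>0$ be fixed and $f\in e_{-\alpha}C^\infty(\mathbf{T}^n_\alpha)$. Then the fractional heat equation of order $\alpha$ $$\frac{\partial}{\partial t}\Big(e_\alpha(x)F_\alpha(x,t)\Big)=k\,\Delta_x\Big(e_\alpha(x)F_\alpha(x,t)\Big),\quad t\in(0,\infty),\ x\in\mathbf{T}^n_\alpha,$$ under the initial condition $F_\alpha(x,0)=f(x)$, $x\in\mathbf{T}^n_\alpha$, has a unique solution which is continuous on $[0,\infty)\times\mathbf{T}^n_\alpha$ and $C^\infty$ on $[0,\infty)\times\mathbf{T}^n_\alpha$, given by $$F_\alpha(x,t)=(f\overset{\alpha}{\ast}H^\alpha_t)(x)=\sum_{m\in\mathbb{Z}^n}\mathcal{F}_\alpha(f)(m)e^{-4\pi^2|m|^2|\csc\alpha|^2kt}K_{-\alpha}(m,x)$$ (the convolution expression being for $t>0$).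
   Context: Let $n\ge 1$ and $\alpha\in\mathbb{R}\setminus\pi\mathbb{Z}$. The fractional torus $\mathbf{T}^n_\alpha$ is the cube of side $|\sin\alpha|$ with opposite sides identified, represented by $[-|\sin\alpha|/2,|\sin\alpha|/2]^n$; functions on $\mathbf{T}^n_\alpha$ are functions on $\mathbb{R}^n$ that are $|\sin\alpha|$-periodic in each coordinate, equivalently functions on this cube, and integrals over $\mathbf{T}^n_\alpha$ are taken over this cube. Put $e_\alpha(x)=e^{\pi i|x|^2\cot\alpha}$, $e_{-\alpha}(x)=e^{-\pi i|x|^2\cot\alpha}$. $e_{-\alpha}C^\infty(\mathbf{T}^n_\alpha)$ is the space of functions $f=e_{-\alpha}g$ on the cube with $g$ a $C^\infty$ function that is $|\sin\alpha|$-periodic in each coordinate; for such $f$, $e_\alpha f$ denotes the periodic function $g$. Likewise, for functions $F(x,t)$ on the cube times $[0,\infty)$, continuity and smoothness on $[0,\infty)\times\mathbf{T}^n_\alpha$ are understood for the function $e_\alpha(x)F(x,t)$, regarded as $|\sin\alpha|$-periodic in $x$. Put $A_\alpha=\sqrt{1-i\cot\alpha}$ (principal branch), $e_\alpha(m,x)=e^{-2\pi i(m\cdot x)\csc\alpha}$, $K_\alpha(m,x)=A_\alpha^n e_\alpha(x)e_\alpha(m,x)e_\alpha(m)$; $K_{-\alpha}$ is obtained by replacing $\alpha$ by $-\alpha$. $\mathcal{F}_\alpha(f)(m)=\int_{\mathbf{T}^n_\alpha}f(x)K_\alpha(m,x)\,dx$, $m\in\mathbb{Z}^n$. For $g\in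 L^1(\mathbf{T}^n)$ ($1$-periodic in each coordinate), $(f\overset{\alpha}{\ast}g)(x)=|\csc\alpha|^n e_{-\alpha}(x)\int_{\mathbf{T}^n_\alpha}e_\alpha(y)f(y)\,g((x-y)\csc\alpha)\,dy$. The fractional heat kernel is $H^\alpha_t(x)=\sum_{m\in\mathbb{Z}^n}e^{-4\pi^2|m|^2|\csc\alpha|^2kt}e^{2\pi im\cdot x}$, $t>0$. *)

(* Defs.v *)
From HB Require Import structures.
From mathcomp Require Import all_boot all_order all_algebra.
From mathcomp Require Import finmap.
From mathcomp Require Import complex.
From mathcomp Require Import all_classical all_reals all_analysis.
From mathcomp Require summability.

Set Implicit Arguments.
Unset Strict Implicit.
Unset Printing Implicit Defensive.

Import Order.TTheory GRing.Theory Num.Theory.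
Import numFieldNormedType.Exports.

Local Open Scope classical_set_scope.
Local Open Scope ring_scope.
Local Open Scope complex_scope.

Section Calculus.
Context {R : realType}.

Definition cis (theta : R) : R[i] := cos theta +i* sin theta.

(* [R[i]] carries no topology over [R]: limits, derivatives, integrals and
   sums of complex-valued functions are taken on real and imaginary parts. *)

Definition iter_derive {V : normedModType R} (vs : seq V) (u : V -> R) : V -> R :=
  foldr (fun v w z => 'D_v w z) u vs.

(* C^oo on a set S contained in the closure of its interior (e.g. a closed
   half-space): u is continuous on S, and every iterated directional derivative
   exists in the interior of S and extends continuously to S.  For S = setT this
   is the usual notion. *)
Definition smooth_on {V : normedModType R} (S : set V) (u : V -> R) : Prop :=
  {within S, continuous u} /\
  forall vs : seq V,
    (forall z v, interior S z -> derivable (iter_derive vs u) z v) /\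
    exists h : V -> R, {within S, continuous h} /\
      forall z, interior S z -> h z = iter_derive vs u z.

Definition ccontinuous_on {V : normedModType R} (S : set V) (u : V -> R[i]) : Prop :=
  {within S, continuous (fun z => complex.Re (u z))} /\
  {within S, continuous (fun z => complex.Im (u z))}.

Definition csmooth_on {V : normedModType R} (S : set V) (u : V -> R[i]) : Prop :=
  smooth_on S (fun z => complex.Re (u z)) /\
  smooth_on S (fun z => complex.Im (u z)).

Definition cderive {V : normedModType R} (v : V) (u : V -> R[i]) (z : V) : R[i] :=
  'D_v (fun y => complex.Re (u y)) z +i* 'D_v (fun y => complex.Im (u y)) z.

(* Integral over the cube [-s/2, s/2]^n, as an iterated Lebesgue integral; it is
   only applied to continuous integrands. *)
Fixpoint cube_int (s : R) (n : nat) : ('rV[R]_n -> R) -> R :=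
  match n return ('rV[R]_n -> R) -> R with
  | 0 => fun h => h 0
  | n'.+1 => fun h =>
      Rintegral lebesgue_measure `[- (s / 2), s / 2]
        (fun a => cube_int s (fun y : 'rV[R]_n' =>
           h (row_mx (a%:M : 'rV[R]_1) y)))
  end.

Definition ccube_int (s : R) {n : nat} (h : 'rV[R]_n -> R[i]) : R[i] :=
  cube_int s (fun x => complex.Re (h x)) +i* cube_int s (fun x => complex.Im (h x)).

(* Unordered sums over Z^n: limits of the net of finite partial sums. *)
Definition has_csum {n : nat} (a : 'rV[int]_n -> R[i]) (S : R[i]) : Prop :=
  (summability.partial_sum (fun m => complex.Re (a m)) @ summability.totally
     --> complex.Re S) /\
  (summability.partial_sum (fun m => complex.Im (a m)) @ summability.totally
     --> complex.Im S).

Definition csum {n : nat} (a : 'rV[int]_n -> R[i]) : R[i] :=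
  lim (summability.partial_sum (fun m => complex.Re (a m)) @ summability.totally) +i*
  lim (summability.partial_sum (fun m => complex.Im (a m)) @ summability.totally).

End Calculus.

Section FractionalTorus.
Context {R : realType}.

Definition cot (alpha : R) : R := cos alpha / sin alpha.
Definition csc (alpha : R) : R := (sin alpha)^-1.

Definition side (alpha : R) : R := `|sin alpha|.

Definition dot {n} (x y : 'rV[R]_n) : R := \sum_i x 0 i * y 0 i.

Definition zvec {n} (m : 'rV[int]_n) : 'rV[R]_n := map_mx intr m.

Definition cube {n} (alpha : R) : set 'rV[R]_n :=
  [set x | forall i, `|x 0 i| <= side alpha / 2].

Definition torus_periodic {n} (alpha : R) (g : 'rV[R]_n -> R[i]) : Prop :=
  forall i x, g (x + side alpha *: delta_mx 0 i) = g x.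

(* e_alpha(x); e_{-alpha} is [chirp (- alpha)] *)
Definition chirp {n} (alpha : R) (x : 'rV[R]_n) : R[i] :=
  cis (pi * dot x x * cot alpha).

(* e_alpha(m, x) *)
Definition wave {n} (alpha : R) (m : 'rV[int]_n) (x : 'rV[R]_n) : R[i] :=
  cis (- (2 * pi * dot (zvec m) x * csc alpha)).

(* A_alpha; [sqrtc] is the principal branch, unlike [sqrtC] *)
Definition amp (alpha : R) : R[i] := sqrtc (1 -i* cot alpha).

(* K_alpha(m, x) *)
Definition frac_kernel {n} (alpha : R) (m : 'rV[int]_n) (x : 'rV[R]_n) : R[i] :=
  amp alpha ^+ n * chirp alpha x * wave alpha m x * chirp alpha (zvec m).

Definition frac_fourier {n} (alpha : R) (f : 'rV[R]_n -> R[i])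
    (m : 'rV[int]_n) : R[i] :=
  ccube_int (side alpha) (fun x => f x * frac_kernel alpha m x).

Definition frac_conv {n} (alpha : R) (f g : 'rV[R]_n -> R[i]) (x : 'rV[R]_n) : R[i] :=
  (`|csc alpha| ^+ n)%:C * chirp (- alpha) x *
  ccube_int (side alpha) (fun y => chirp alpha y * f y * g (csc alpha *: (x - y))).

Definition heat_decay {n} (alpha k t : R) (m : 'rV[int]_n) : R :=
  expR (- (4 * pi ^+ 2 * dot (zvec m) (zvec m) * `|csc alpha| ^+ 2 * k * t)).

Definition frac_heat_kernel {n} (alpha k t : R) (x : 'rV[R]_n) : R[i] :=
  csum (fun m => (heat_decay alpha k t m)%:C * cis (2 * pi * dot (zvec m) x)).

(* Functions on the torus are functions of which only the values on the cube
   matter; g is the periodic function denoted by e_alpha h. *)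
Definition torus_lift {n} (alpha : R) (h g : 'rV[R]_n -> R[i]) : Prop :=
  torus_periodic alpha g /\ forall x, cube alpha x -> g x = chirp alpha x * h x.

(* f \in e_{-alpha} C^oo(T^n_alpha) *)
Definition chirp_smooth {n} (alpha : R) (f : 'rV[R]_n -> R[i]) : Prop :=
  exists g : 'rV[R]_n -> R[i],
    [/\ torus_periodic alpha g, csmooth_on setT g
      & forall x, cube alpha x -> f x = chirp (- alpha) x * g x].

Definition half_space {n} : set (R * 'rV[R]_n) := [set z | 0 <= z.1].

Definition time_dir {n} : R * 'rV[R]_n := (1, 0).
Definition space_dir {n} (i : 'I_n) : R * 'rV[R]_n := (0, delta_mx 0 i).

Definition laplacian_x {n} (G : R * 'rV[R]_n -> R[i]) (z : R * 'rV[R]_n) : R[i] :=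
  \sum_(i < n) cderive (space_dir i) (cderive (space_dir i) G) z.

(* G (t, x) is the x-periodic function denoted by e_alpha(x) F(x, t). *)
Definition heat_solution {n} (alpha k : R) (f : 'rV[R]_n -> R[i])
    (F : 'rV[R]_n -> R -> R[i]) : Prop :=
  exists G : R * 'rV[R]_n -> R[i],
    [/\ forall t, 0 <= t -> torus_lift alpha (fun x => F x t) (fun x => G (t, x)),
        ccontinuous_on half_space G,
        csmooth_on half_space G,
        forall t x, 0 < t -> cube alpha x ->
          cderive time_dir G (t, x) = k%:C * laplacian_x G (t, x)
      & forall x, cube alpha x -> F x 0 = f x].

End FractionalTorus.

(* Main.v *)
Require Import Defs.
From HB Require Import structures.
From mathcomp Require Import all_boot all_order all_algebra.
From mathcomp Require Import finmap.
From mathcomp Require Import complex.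
From mathcomp Require Import all_classical all_reals all_analysis.
From mathcomp Require summability.
From mathcomp Require Import ring lra zify.

Set Implicit Arguments.
Unset Strict Implicit.
Unset Printing Implicit Defensive.

Import Order.TTheory GRing.Theory Num.Theory.
Import numFieldNormedType.Exports.

Local Open Scope classical_set_scope.
Local Open Scope ring_scope.
Local Open Scope complex_scope.

(** Put [s = |sin alpha|] and [w = 2 pi csc alpha], so that [|w| s = 2 pi].
    Multiplying by the chirp [e_alpha] turns the problem into the ordinary heat
    equation on the torus [R^n / s Z^n] for [G = e_alpha F], with the smooth
    periodic initial datum [g = e_alpha f].  All chirps cancel in the product
    [F_alpha(f)(m) K_(-alpha)(m, x)], and [A_alpha A_(-alpha) = |csc alpha|]
    ([ampN]), so the claimed expansion is the Fourier series of [g] on that torus,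
    each mode being damped by [exp (- 4 pi^2 |m|^2 csc^2 k t)].

    Existence.  Integration by parts over the cube ([cube_int_deriv0],
    [fourier_int_derive]) shows that the Fourier coefficients of [g] decay faster
    than any power of the frequency ([fourier_int_rapid]).  A directional derivative
    in space-time multiplies the coefficients by a polynomial in the frequency, so
    the class of series with rapidly decreasing coefficients is stable under all
    derivatives for [t > 0] ([heat_series_derive_Re], proved by a second-order Taylor
    bound that can be summed over the frequencies), and each of these series is
    continuous up to [t = 0].  This is smoothness on the closed half-space
    ([heat_series_smooth]), and the equation holds mode by mode
    ([heat_series_equation]).

    Initial value.  At [t = 0] the series has the same Fourier coefficients as [g],
    so it equals [g] by the uniqueness theorem [fourier_unique].  That theorem
    reduces to one variable by slicing; in one variable it is a Korovkin argument
    with the powers of [(1 + cos) / 2] as peaked weights, whose total masses satisfy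
    the recursion of Wallis ([peak_massS]).

    Uniqueness.  The difference of two solutions satisfies the heat equation with
    zero initial datum, and vanishes by the maximum principle on the compact set
    [[0, t] x cube]; periodicity takes care of maxima on the faces of the cube
    ([heat_max_principle]).

    Convolution.  For [t > 0] the heat kernel is itself such a series, and
    integrating it term by term against [g] ([heat_series_exchange]) gives the series
    of the solution. *)

(** * Unordered sums *)

Section UnorderedSums.
Context {R : realType} {I : choiceType}.
Implicit Types (a b : I -> R) (A C : {fset I}).

Lemma partial_sumE a A : summability.partial_sum a A = \sum_(i <- A) a i.
Proof. by rewrite /summability.partial_sum big_seq_fsetE. Qed.

Definition has_rsum a (S : R) : Prop :=
  summability.partial_sum a @ summability.totally --> S.

Lemma has_rsumP a S : has_rsum a S <->
  forall e, 0 < e -> exists A0, forall A, (A0 `<=` A)%fset ->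
    `|\sum_(i <- A) a i - S| <= e.
Proof.
have TF := @summability.totally_filter I.
split=> [|H].
  rewrite /has_rsum => aS e e0.
  have [A0 _ A0P] := (@cvgr_dist_le _ _ _ _ TF _ _ aS e e0).
  by exists A0 => A /A0P /=; rewrite distrC partial_sumE.
apply/cvgrPdistC_le => e e0.
have [A0 A0P] := H e e0.
by exists A0 => // A /A0P /=; rewrite partial_sumE.
Qed.

Lemma has_rsum_unique a S S' : has_rsum a S -> has_rsum a S' -> S = S'.
Proof.
have TF := @summability.totally_filter I.
by move=> /(cvg_lim (@Rhausdorff R)) <- /(cvg_lim (@Rhausdorff R)) <-.
Qed.

Lemma has_rsum_lim a S : has_rsum a S ->
  lim (summability.partial_sum a @ summability.totally) = S.
Proof. by have TF := @summability.totally_filter I; move=> h; apply: cvg_lim. Qed.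

Lemma has_rsumD a a' S S' : has_rsum a S -> has_rsum a' S' ->
  has_rsum (fun i => a i + a' i) (S + S').
Proof.
move=> /has_rsumP aS /has_rsumP aS'; apply/has_rsumP => e e0.
have e20 : 0 < e / 2 by rewrite divr_gt0.
have [A1 A1P] := aS _ e20; have [A2 A2P] := aS' _ e20.
exists (A1 `|` A2)%fset => A; rewrite fsubUset => /andP[/A1P h1 /A2P h2].
rewrite big_split /= opprD addrACA (splitr e).
by rewrite (le_trans (ler_normD _ _)) // lerD.
Qed.

Lemma has_rsumZ a S (k : R) : has_rsum a S -> has_rsum (fun i => k * a i) (k * S).
Proof.
move=> /has_rsumP aS; apply/has_rsumP => e e0.
have k0 : 0 < `|k| + 1 by rewrite ltr_pwDr.
have [A0 A0P] := aS (e / (`|k| + 1)) (divr_gt0 e0 k0).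
exists A0 => A /A0P h.
rewrite -big_distrr /= -mulrBr normrM.
apply: (@le_trans _ _ ((`|k| + 1) * (e / (`|k| + 1)))).
  by apply: ler_pM => //; rewrite lerDl.
by rewrite mulrCA divff ?mulr1 // gt_eqF.
Qed.

Definition dominating b : Prop :=
  (forall i, 0 <= b i) /\ exists B, forall A, \sum_(i <- A) b i <= B.

Lemma sum_fsetU b A C : [disjoint A & C]%fset ->
  \sum_(i <- (A `|` C)%fset) b i = \sum_(i <- A) b i + \sum_(i <- C) b i.
Proof.
move=> dAC; rewrite (big_fsetID _ (mem A)) /=; congr (_ + _).
  apply: eq_fbigl => i; rewrite !inE /=.
  by case: (i \in A); rewrite /= ?andbF.
apply: eq_fbigl => i; rewrite !inE /=.
case: (boolP (i \in A)) => iA /=; rewrite ?andbF ?andbT //.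
by have /fdisjointP/(_ _ iA)/negbTE -> := dAC.
Qed.

Lemma sum_fsubset b A C : (A `<=` C)%fset ->
  \sum_(i <- C) b i = \sum_(i <- A) b i + \sum_(i <- (C `\` A)%fset) b i.
Proof.
move=> AC; rewrite -sum_fsetU; last by apply/fdisjointP => i iA; rewrite !inE iA.
suff {1}-> : C = (A `|` (C `\` A))%fset by [].
apply/fsetP => i; rewrite !inE.
by case: (boolP (i \in A)) => //= /(fsubsetP AC).
Qed.

(** A finite set whose sum is within [e] of the supremum of all finite sums
    leaves at most [e] for any finite set disjoint from it. *)
Lemma dominating_tail b : dominating b -> forall e, 0 < e ->
  exists A0, forall C, [disjoint A0 & C]%fset -> \sum_(i <- C) b i <= e.
Proof.
move=> [b0 [B bB]] e e0.
pose E := [set \sum_(i <- A) b i | A in [set: {fset I}]].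
have sE : has_sup E.
  split; first by exists (\sum_(i <- fset0 : {fset I}) b i), fset0.
  by exists B => _ [A _ <-].
have [_ [A0 _ <-] A0P] := sup_adherent e0 sE.
exists A0 => C dC.
have : \sum_(i <- (A0 `|` C)%fset) b i <= sup E.
  by apply: ub_le_sup; [exact: sE.2|exists (A0 `|` C)%fset].
rewrite sum_fsetU //; lra.
Qed.

Lemma dominating_has_rsum b : dominating b -> exists S, has_rsum b S.
Proof.
move=> db; have [b0 [B bB]] := db.
pose E := [set \sum_(i <- A) b i | A in [set: {fset I}]].
have sE : has_sup E.
  split; first by exists (\sum_(i <- fset0 : {fset I}) b i), fset0.
  by exists B => _ [A _ <-].
exists (sup E); apply/has_rsumP => e e0.
have [_ [A0 _ <-] A0P] := sup_adherent e0 sE.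
exists A0 => A A0A.
have h1 : \sum_(i <- A) b i <= sup E.
  by apply: ub_le_sup; [exact: sE.2|exists A].
have h2 : \sum_(i <- A0) b i <= \sum_(i <- A) b i.
  by rewrite (sum_fsubset _ A0A) lerDl sumr_ge0.
rewrite ler_norml; apply/andP; split; lra.
Qed.

Lemma dominatingD b b' : dominating b -> dominating b' ->
  dominating (fun i => b i + b' i).
Proof.
move=> [b0 [B bB]] [b'0 [B' bB']]; split; first by move=> i; rewrite addr_ge0.
by exists (B + B') => A; rewrite big_split lerD.
Qed.

Lemma dominatingZ b (k : R) : 0 <= k -> dominating b -> dominating (fun i => k * b i).
Proof.
move=> k0 [b0 [B bB]]; split; first by move=> i; rewrite mulr_ge0.
by exists (k * B) => A; rewrite -big_distrr /= ler_wpM2l.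
Qed.

Lemma le_dominating a b : (forall i, 0 <= a i <= b i) -> dominating b -> dominating a.
Proof.
move=> ab [b0 [B bB]]; split; first by move=> i; have /andP[] := ab i.
exists B => A; apply: le_trans (bB A).
by apply: ler_sum => i _; have /andP[] := ab i.
Qed.

(** Both terms of [a = (a + b) - b] are families of non-negative numbers with
    bounded finite sums, which converge to their suprema. *)
Lemma dominated_has_rsum a b : dominating b -> (forall i, `|a i| <= b i) ->
  exists S, has_rsum a S.
Proof.
move=> db ab; have [S bS] := dominating_has_rsum db.
have [S' aS'] : exists S', has_rsum (fun i => a i + b i) S'.
  apply: dominating_has_rsum; apply: le_dominating (dominatingD db db) => i.
  by have := ab i; rewrite ler_norml; lra.
exists (S' + (-1) * S).
have := has_rsumD aS' (has_rsumZ (k := -1) bS).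
by congr has_rsum; apply/funext => i; ring.
Qed.

(** The finite set depends on the bound [b] only.  Applied to a family that
    depends on a parameter, this gives convergence uniformly in the parameter. *)
Lemma dominated_uniform b : dominating b -> forall e, 0 < e ->
  exists A0, forall a S, (forall i, `|a i| <= b i) -> has_rsum a S ->
    forall A, (A0 `<=` A)%fset -> `|\sum_(i <- A) a i - S| <= e.
Proof.
move=> db e e0.
have [A0 A0P] := dominating_tail db e0.
exists A0 => a S ab /has_rsumP aS A A0A.
apply/ler_addgt0Pr => e' e'0.
have [A1 A1P] := aS e' e'0.
have {}A1P := A1P (A `|` A1)%fset (fsubsetUr _ _).
rewrite (sum_fsubset _ (fsubsetUl A A1)) in A1P.
set x := \sum_(i <- A) _ in A1P *; set y := \sum_(i <- _) _ in A1P.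
have hy : `|y| <= e.
  apply: le_trans (ler_norm_sum _ _ _) _.
  apply: (@le_trans _ _ (\sum_(i <- ((A `|` A1) `\` A)%fset) b i)).
    exact: ler_sum.
  apply: A0P; apply/fdisjointP => i iA.
  by rewrite !inE (fsubsetP A0A _ iA).
move: hy A1P; rewrite !ler_norml => /andP[? ?] /andP[? ?]; apply/andP; split; lra.
Qed.

Lemma has_rsum_le a b S B : (forall i, `|a i| <= b i) ->
  (forall A, \sum_(i <- A) b i <= B) -> has_rsum a S -> `|S| <= B.
Proof.
move=> ab bB /has_rsumP aS; apply/ler_addgt0Pr => e e0.
have [A0 /(_ A0 (fsubset_refl _))] := aS e e0.
set x := \sum_(i <- A0) _ => h.
have hx : `|x| <= B.
  apply: le_trans (ler_norm_sum _ _ _) _.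
  by apply: le_trans (bB A0); apply: ler_sum.
move: h hx; rewrite !ler_norml => /andP[? ?] /andP[? ?]; apply/andP; split; lra.
Qed.

End UnorderedSums.

Section ComplexSums.
Context {R : realType}.
Implicit Types (z w : R[i]).

(** The modulus in the l1 form: it is submultiplicative, and it bounds the
    real and the imaginary part, on which limits of complex functions are taken. *)
Definition norm1 z : R := `|complex.Re z| + `|complex.Im z|.

Lemma norm1_ge0 z : 0 <= norm1 z. Proof. exact: addr_ge0. Qed.

Lemma Re_le_norm1 z : `|complex.Re z| <= norm1 z. Proof. by rewrite lerDl. Qed.
Lemma Im_le_norm1 z : `|complex.Im z| <= norm1 z. Proof. by rewrite lerDr. Qed.

Lemma ReM z w : complex.Re (z * w) =
  complex.Re z * complex.Re w - complex.Im z * complex.Im w.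
Proof. by case: z w => a b [c d]. Qed.

Lemma ImM z w : complex.Im (z * w) =
  complex.Re z * complex.Im w + complex.Im z * complex.Re w.
Proof. by case: z w => a b [c d]. Qed.

Lemma ReD z w : complex.Re (z + w) = complex.Re z + complex.Re w.
Proof. by case: z w => a b [c d]. Qed.

Lemma ImD z w : complex.Im (z + w) = complex.Im z + complex.Im w.
Proof. by case: z w => a b [c d]. Qed.

Lemma ReB z w : complex.Re (z - w) = complex.Re z - complex.Re w.
Proof. by case: z w => a b [c d]. Qed.

Lemma ImB z w : complex.Im (z - w) = complex.Im z - complex.Im w.
Proof. by case: z w => a b [c d]. Qed.

Lemma complexP z w : complex.Re z = complex.Re w -> complex.Im z = complex.Im w -> z = w.
Proof. by case: z w => a b [c d] /= -> ->. Qed.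

Lemma Re_sum (J : Type) (r : seq J) (F : J -> R[i]) :
  complex.Re (\sum_(i <- r) F i) = \sum_(i <- r) complex.Re (F i).
Proof. by elim/big_rec2: _ => // i x y _ <-; rewrite ReD. Qed.

Lemma Im_sum (J : Type) (r : seq J) (F : J -> R[i]) :
  complex.Im (\sum_(i <- r) F i) = \sum_(i <- r) complex.Im (F i).
Proof. by elim/big_rec2: _ => // i x y _ <-; rewrite ImD. Qed.

Lemma norm1_real (x : R) : norm1 x%:C = `|x|.
Proof. by rewrite /norm1 /= normr0 addr0. Qed.

Lemma norm1M z w : norm1 (z * w) <= norm1 z * norm1 w.
Proof.
rewrite /norm1 ReM ImM.
apply: le_trans (lerD (ler_normB _ _) (ler_normD _ _)) _.
rewrite !normrM; lra.
Qed.

Lemma norm1_cis (x : R) : norm1 (cis x) <= 2.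
Proof. by rewrite /norm1 /= -[2]/(1 + 1) lerD ?cos_max ?sin_max. Qed.

Lemma cisD (x y : R) : cis (x + y) = cis x * cis y.
Proof.
apply: complexP; rewrite ?ReM ?ImM /= ?cosD ?sinD //; ring.
Qed.

Lemma cis0 : cis (0 : R) = 1.
Proof. by rewrite /cis cos0 sin0. Qed.

End ComplexSums.

Section ComplexUnorderedSums.
Context {R : realType} {n : nat}.
Implicit Types (a : 'rV[int]_n -> R[i]) (b : 'rV[int]_n -> R).

Lemma has_csum_unique a S S' : has_csum a S -> has_csum a S' -> S = S'.
Proof.
move=> [r i] [r' i']; apply: complexP.
  exact: has_rsum_unique r r'.
exact: has_rsum_unique i i'.
Qed.

Lemma has_csum_csum a S : has_csum a S -> csum a = S.
Proof.
by move=> [/has_rsum_lim r /has_rsum_lim i]; rewrite /csum r i; case: S {r i}.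
Qed.

Lemma has_csumZ a S c : has_csum a S -> has_csum (fun m => c * a m) (c * S).
Proof.
move=> [r i]; split.
  rewrite ReM.
  have := has_rsumD (has_rsumZ (k := complex.Re c) r) (has_rsumZ (k := - complex.Im c) i).
  rewrite mulNr.
  by congr (has_rsum _ _); apply/funext => m; rewrite ReM mulNr.
rewrite ImM.
have := has_rsumD (has_rsumZ (k := complex.Re c) i) (has_rsumZ (k := complex.Im c) r).
by congr (has_rsum _ _); apply/funext => m; rewrite ImM.
Qed.

Lemma has_csumD a a' S S' : has_csum a S -> has_csum a' S' ->
  has_csum (fun m => a m + a' m) (S + S').
Proof.
move=> [r i] [r' i']; split.
  rewrite ReD; have := has_rsumD r r'.
  by congr (has_rsum _ _); apply/funext => m; rewrite ReD.
rewrite ImD; have := has_rsumD i i'.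
by congr (has_rsum _ _); apply/funext => m; rewrite ImD.
Qed.

Lemma dominated_csum a b : dominating b -> (forall m, norm1 (a m) <= b m) ->
  has_csum a (csum a).
Proof.
move=> db ab.
have [r hr] : exists S, has_rsum (fun m => complex.Re (a m)) S.
  by apply: dominated_has_rsum db _ => m; apply: le_trans (ab m); exact: Re_le_norm1.
have [i hi] : exists S, has_rsum (fun m => complex.Im (a m)) S.
  by apply: dominated_has_rsum db _ => m; apply: le_trans (ab m); exact: Im_le_norm1.
by have h : has_csum a (r +i* i) by []; rewrite (has_csum_csum h).
Qed.

End ComplexUnorderedSums.

(** * Rapidly decreasing families on the integer lattice *)

Section Rapid.
Context {R : realType} {n : nat}.
Implicit Types (b c : 'rV[int]_n -> R) (vs : seq 'I_n) (m : 'rV[int]_n).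

(** Decay faster than any polynomial, tested on the monomials given by lists
    of coordinates; stability under multiplication by a coordinate is then immediate. *)
Definition rapid b : Prop := forall vs, exists C, forall m,
  `|b m| * \prod_(i <- vs) `|(m 0 i)%:~R| <= C.

Lemma le_rapid b c : (forall m, `|b m| <= `|c m|) -> rapid c -> rapid b.
Proof.
move=> bc rc vs; have [C CP] := rc vs; exists C => m; apply: le_trans (CP m).
by rewrite ler_wpM2r ?prodr_ge0.
Qed.

Lemma rapidD b c : rapid b -> rapid c -> rapid (fun m => b m + c m).
Proof.
move=> rb rc vs; have [B BP] := rb vs; have [C CP] := rc vs.
exists (B + C) => m; apply: le_trans (lerD (BP m) (CP m)).
by rewrite -mulrDl ler_wpM2r ?prodr_ge0 ?ler_normD.
Qed.

Lemma rapidZ b k : rapid b -> rapid (fun m => k * b m).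
Proof.
move=> rb vs; have [B BP] := rb vs.
exists (`|k| * B) => m; rewrite normrM -mulrA.
by rewrite ler_wpM2l.
Qed.

Lemma rapid_coord b i : rapid b -> rapid (fun m => (m 0 i)%:~R * b m).
Proof.
move=> rb vs; have [B BP] := rb (i :: vs); exists B => m.
by apply: le_trans (BP m); rewrite normrM big_cons mulrCA mulrA.
Qed.

Lemma rapid_sum (J : Type) (r : seq J) (F : J -> 'rV[int]_n -> R) :
  (forall j, rapid (F j)) -> rapid (fun m => \sum_(j <- r) F j m).
Proof.
move=> rF; elim: r => [|j r IH].
  move=> vs; exists 0 => m; rewrite big_nil normr0 mul0r //.
apply: le_rapid (rapidD (rF j) IH) => m; by rewrite big_cons.
Qed.

Lemma shift_absz (z : int) (N : nat) : (absz z <= N)%N ->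
  (absz (z + N%:Z)%R < N.*2.+1)%N /\ z = (absz (z + N%:Z)%R)%:Z - N%:Z.
Proof. by move=> zN; split; lia. Qed.

Definition box_weight m : R := \prod_i (1 + (m 0 i)%:~R ^+ 2)^-1.

(** Passing from [N] to [N + 1] adds [2 / (1 + (N + 1)^2)], which is at most
    [4 / (N + 1) - 4 / (N + 2)], so the bound telescopes. *)
Lemma lorentz_sum (N : nat) :
  \sum_(j < N.*2.+1) (1 + (j%:Z - N%:Z)%:~R ^+ 2)^-1 <= 5 - 4 / N.+1%:R :> R.
Proof.
elim: N => [|N IH].
  rewrite big_ord_recl big_ord0 /= subrr mulr0z expr0n /= !addr0 invr1.
  by lra.
rewrite doubleS big_ord_recl big_ord_recr /=.
have -> : \sum_(i < N.*2.+1)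
   (1 + ((bump 0 (widen_ord (leqnSn _) i))%:Z - N.+1%:Z)%:~R ^+ 2)^-1
   = \sum_(j < N.*2.+1) (1 + (j%:Z - N%:Z)%:~R ^+ 2)^-1 :> R.
  apply: eq_bigr => i _; congr (1 + _%:~R ^+ 2)^-1; rewrite /bump /= add1n; lia.
have -> : (0%:Z - N.+1%:Z)%:~R ^+ 2 = N.+1%:R ^+ 2 :> R.
  by rewrite sub0r rmorphN /= sqrrN.
have -> : ((bump 0 N.*2.+1)%:Z - N.+1%:Z)%:~R ^+ 2 = N.+1%:R ^+ 2 :> R.
  by rewrite /bump /= add1n; have -> : (N.*2.+2)%:Z - N.+1%:Z = N.+1%:Z by lia.
have -> : N.+2%:R = N.+1%:R + 1 :> R by rewrite -natr1.
have : 1 <= N.+1%:R :> R by rewrite ler1n.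
move: (N.+1%:R : R) IH => x IH x1; have x0 : 0 < x by exact: lt_le_trans x1.
have : 2 * (1 + x ^+ 2)^-1 <= 4 / x - 4 / (x + 1).
  have -> : 4 / x - 4 / (x + 1) = 4 / (x * (x + 1)).
    by field; rewrite !gt_eqF // addr_gt0.
  rewrite ler_pdivlMr ?mulr_gt0 //; last lra.
  rewrite mulrAC ler_pdivrMr; last by nra.
  by nra.
move: IH; lra.
Qed.

Lemma box_weight_ge0 m : 0 <= box_weight m.
Proof. by apply: prodr_ge0 => i _; rewrite invr_ge0 addr_ge0 ?sqr_ge0. Qed.

(** A finite set of lattice points is contained in a box, and the sum of the
    weights over a box is the n-th power of a one-dimensional sum. *)
Lemma box_weight_dominating : dominating box_weight.
Proof.
split; first exact: box_weight_ge0.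
exists (5 ^+ n) => A.
pose N := (\max_(m <- A) \max_(i < n) absz (m ord0 i))%N.
have AN (m : 'rV[int]_n) i : m \in A -> (absz (m ord0 i) <= N)%N.
  move=> mA; apply: leq_trans (leq_bigmax_seq _ mA isT).
  exact: (leq_bigmax i).
pose rho (phi : {ffun 'I_n -> 'I_(N.*2.+1)}) : 'rV[int]_n :=
  \row_i ((phi i)%:Z - N%:Z).
have rho_inj : injective rho.
  move=> phi psi /rowP eq; apply/ffunP => i; apply: val_inj => /=.
  by have := eq i; rewrite !mxE; lia.
pose B := [fset rho phi | phi in [fset phi : {ffun 'I_n -> 'I_(N.*2.+1)} | true]]%fset.
have AB : (A `<=` B)%fset.
  apply/fsubsetP => m mA; apply/imfsetP.
  exists [ffun i => inord (absz (m ord0 i + N%:Z)%R)]; first by rewrite !inE.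
  apply/rowP => i; have [h1 h2] := shift_absz (AN m i mA).
  by rewrite !mxE ffunE inordK.
apply: (@le_trans _ _ (\sum_(m <- B) box_weight m)).
  by rewrite (sum_fsubset _ AB) lerDl sumr_ge0 // => m _; exact: box_weight_ge0.
rewrite big_imfset /=; last by move=> x y _ _; exact: rho_inj.
rewrite big_fset /= big_enum /=.
have -> : \sum_(phi : {ffun 'I_n -> 'I_(N.*2.+1)}) box_weight (rho phi) =
    \prod_(i < n) \sum_(j < N.*2.+1) (1 + (j%:Z - N%:Z)%:~R ^+ 2)^-1.
  rewrite bigA_distr_bigA /=; apply: eq_bigr => phi _.
  by apply: eq_bigr => i _; rewrite mxE.
rewrite -[X in 5 ^+ X]card_ord -prodr_const.
apply: ler_prod => i _; apply/andP; split.
  by apply: sumr_ge0 => j _; rewrite invr_ge0 addr_ge0 ?sqr_ge0.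
apply: le_trans (lorentz_sum N) _.
by rewrite gerBl divr_ge0.
Qed.

(** Rapid decay is preserved by the factor [\prod_i (1 + (m 0 i)^2)], so a
    rapidly decreasing family is bounded by a multiple of [box_weight]. *)
Lemma rapid_dominating b : rapid b -> dominating (fun m => `|b m|).
Proof.
move=> rb.
have key r : rapid (fun m => \prod_(i <- r) (1 + (m 0 i)%:~R ^+ 2) * b m).
  elim: r => [|i r IH]; first by apply: le_rapid rb => m; rewrite big_nil mul1r.
  apply: le_rapid (rapidD IH (rapid_coord i (rapid_coord i IH))) => m.
  rewrite big_cons le_eqVlt; apply/orP; left; apply/eqP; congr `|_|; ring.
have [C CP] := key (index_enum 'I_n) [::].
have C0 : 0 <= C.
  by apply: le_trans (CP 0); rewrite big_nil mulr1 normr_ge0.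
apply: le_dominating (dominatingZ C0 box_weight_dominating) => m.
rewrite normr_ge0 /= /box_weight.
have := CP m; rewrite big_nil mulr1 normrM prodfV.
have P0 : 0 < \prod_(i < n) (1 + (m 0 i)%:~R ^+ 2) :> R.
  by apply: prodr_gt0 => i _; rewrite ltr_pwDl ?sqr_ge0.
by rewrite ger0_norm ?(ltW P0) // ler_pdivlMr // mulrC.
Qed.

Lemma normz_le1Dsqr (z : int) : `|z%:~R| <= 1 + z%:~R * z%:~R :> R.
Proof. by rewrite ler_norml; apply/andP; split; nra. Qed.

(** The exponential is split into [size vs + 1] equal factors, all but one of
    which absorb one coordinate of the monomial each. *)
Lemma gauss_rapid (l : R) : 0 < l ->
  rapid (fun m => expR (- (l * dot (zvec m) (zvec m)))).
Proof.
move=> l0 vs.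
(* One factor more than needed, so that the list may be empty. *)
pose p := (size vs).+1; pose mu := l / p%:R.
have p0 : 0 < p%:R :> R by rewrite ltr0n.
have mu0 : 0 < mu by rewrite divr_gt0.
pose K := 1 + mu^-1.
have K0 : 0 <= K by rewrite addr_ge0 ?invr_ge0 ?ltW.
exists (K ^+ size vs) => m.
set X := dot (zvec m) (zvec m).
have X0 : 0 <= X by apply: sumr_ge0 => i _; rewrite -expr2 sqr_ge0.
have Xi i : `|(m 0 i)%:~R| <= 1 + X.
  apply: le_trans (normz_le1Dsqr _) _; rewrite lerD2l /X /dot (bigD1 i) //= !mxE lerDl.
  by apply: sumr_ge0 => j _; rewrite -expr2 sqr_ge0.
have step i : expR (- (mu * X)) * `|(m 0 i)%:~R| <= K.
  rewrite expRN mulrC ler_pdivrMr ?expR_gt0 //.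
  apply: le_trans (Xi i) _.
  apply: (@le_trans _ _ (K * (1 + mu * X))); last first.
    by rewrite ler_wpM2l // expR_ge1Dx.
  have : mu^-1 * mu = 1 by rewrite mulVf ?gt_eqF.
  rewrite /K; have : 0 < mu^-1 by rewrite invr_gt0.
  nra.
rewrite ger0_norm ?expR_ge0 //.
apply: (@le_trans _ _ (expR (- (mu * X)) ^+ size vs * \prod_(i <- vs) `|(m 0 i)%:~R|)).
  apply: ler_wpM2r; first exact: prodr_ge0.
  rewrite -expRM_natl ler_expR mulrN lerN2 mulrA ler_wpM2r //.
  rewrite /mu mulrC -mulrA ger_pMr // mulrC ler_pdivrMr // mul1r.
  by rewrite ler_nat.
elim: (vs) => [|i r IH]; first by rewrite big_nil mulr1.
rewrite big_cons /= !exprS mulrACA ler_pM //; try exact: mulr_ge0 (expR_ge0 _) _.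
by rewrite mulr_ge0 ?exprn_ge0 ?expR_ge0 ?prodr_ge0.
Qed.

End Rapid.

(** * Integration over the cube *)

Section ContinuousCombinators.
Context {R : realType} {T : topologicalType}.
Implicit Types f g : T -> R.

Lemma addf_continuous f g : continuous f -> continuous g ->
  continuous (fun x => f x + g x).
Proof. by move=> cf cg x; exact: (cvgD (cf x) (cg x)). Qed.

Lemma subf_continuous f g : continuous f -> continuous g ->
  continuous (fun x => f x - g x).
Proof. by move=> cf cg x; exact: (cvgB (cf x) (cg x)). Qed.

Lemma mulf_continuous f g : continuous f -> continuous g ->
  continuous (fun x => f x * g x).
Proof. by move=> cf cg x; exact: (cvgM (cf x) (cg x)). Qed.

Lemma sumf_continuous (J : Type) (r : seq J) (F : J -> T -> R) :
  (forall j, continuous (F j)) -> continuous (fun x => \sum_(j <- r) F j x).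
Proof.
move=> cF; elim: r => [|j r IH].
  by under eq_fun do rewrite big_nil; exact: cst_continuous.
by under eq_fun do rewrite big_cons; exact: addf_continuous.
Qed.

End ContinuousCombinators.

Section IntervalIntegral.
Context {R : realType}.
Implicit Types (s : R) (phi psi : R -> R).

Definition seg_int s phi : R := Rintegral lebesgue_measure `[- (s / 2), s / 2] phi.

Lemma continuous_integrable s phi : continuous phi ->
  lebesgue_measure.-integrable `[- (s / 2), s / 2] (EFin \o phi).
Proof.
move=> cphi; apply: continuous_compact_integrable; first exact: segment_compact.
exact: continuous_subspaceT.
Qed.

Lemma seg_int_ext s phi psi : (forall a, `|a| <= s / 2 -> phi a = psi a) ->
  seg_int s phi = seg_int s psi.
Proof.
move=> h; apply: eq_Rintegral => a; rewrite inE /= in_itv /= => ha.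
by apply: h; rewrite ler_norml.
Qed.

Lemma seg_int_cst s k : 0 <= s -> seg_int s (fun=> k) = k * s.
Proof.
move=> s0; rewrite /seg_int Rintegral_cst //.
have E := @lebesgue_measure_itv R `[- (s / 2), s / 2]%R.
transitivity (k * fine (if ((- (s / 2))%:E < (s / 2)%:E)%E then
    ((s / 2)%:E - (- (s / 2))%:E)%E else 0%E)); first by congr (_ * fine _).
rewrite lte_fin.
case: ltP => h /=; first by congr (_ * _); lra.
by congr (_ * _); lra.
Qed.

Lemma seg_int_le s phi psi : continuous phi -> continuous psi ->
  (forall a, `|a| <= s / 2 -> phi a <= psi a) -> seg_int s phi <= seg_int s psi.
Proof.
move=> cphi cpsi h; apply: le_Rintegral => //; try exact: continuous_integrable.
by move=> a /=; rewrite in_itv /= => ha; apply: h; rewrite ler_norml.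
Qed.

Lemma seg_int_bound s phi M : 0 <= s -> continuous phi ->
  (forall a, `|a| <= s / 2 -> `|phi a| <= M) -> `|seg_int s phi| <= s * M.
Proof.
move=> s0 cphi h; rewrite ler_norml mulrC -mulNr -!seg_int_cst //.
by apply/andP; split; apply: seg_int_le => //; try exact: cst_continuous;
   move=> a /h; rewrite ler_norml => /andP[].
Qed.

Lemma seg_int_FTC s (Phi phi : R -> R) : 0 < s -> continuous phi ->
  (forall a : R, is_derive a (1 : R) Phi (phi a)) ->
  seg_int s phi = Phi (s / 2) - Phi (- (s / 2)).
Proof.
move=> s0 cphi dPhi; rewrite /seg_int /Rintegral.
have ltS : - (s / 2) < s / 2 by lra.
have cPhi : continuous Phi.
  by move=> a; apply: differentiable_continuous; apply/derivable1_diffP; have [] := dPhi a.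
rewrite (continuous_FTC2 ltS _ _ (F := Phi)) //.
- exact: continuous_subspaceT.
- split; first by move=> a _; have [] := dPhi a.
  + by apply: cvg_at_right_filter; exact: cPhi.
  + by apply: cvg_at_left_filter; exact: cPhi.
- by move=> a _; rewrite derive1E; exact: (derive_val (is_derive := dPhi a)).
Qed.

Lemma seg_intZ s (f : R -> R) k : continuous f ->
  seg_int s (fun a => k * f a) = k * seg_int s f.
Proof.
move=> cf; rewrite /seg_int RintegralZl //; exact: continuous_integrable.
Qed.

Lemma seg_intB s (f g : R -> R) : continuous f -> continuous g ->
  seg_int s (fun a => f a - g a) = seg_int s f - seg_int s g.
Proof.
by move=> cf cg; rewrite /seg_int RintegralB //; exact: continuous_integrable.
Qed.

Lemma seg_intD s (f g : R -> R) : continuous f -> continuous g ->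
  seg_int s (fun a => f a + g a) = seg_int s f + seg_int s g.
Proof.
by move=> cf cg; rewrite /seg_int RintegralD //; exact: continuous_integrable.
Qed.

Lemma seg_int_lin s phi psi k : continuous phi -> continuous psi ->
  seg_int s (fun a => phi a + k * psi a) = seg_int s phi + k * seg_int s psi.
Proof.
move=> cphi cpsi; rewrite seg_intD ?seg_intZ //.
by apply: mulf_continuous => //; exact: cst_continuous.
Qed.

End IntervalIntegral.

Section CubeIntegral.
Context {R : realType}.
Implicit Types (s : R).

(** The cube with its side as parameter: [cube alpha] is [box (side alpha)] by
    definition. *)
Definition box s n : set 'rV[R]_n := [set x | forall i, `|x 0 i| <= s / 2].

Definition vcons n (a : R) (y : 'rV[R]_n) : 'rV[R]_n.+1 :=
  row_mx (a%:M : 'rV[R]_1) y.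

Lemma vcons0 n a (y : 'rV[R]_n) : vcons a y 0 ord0 = a.
Proof.
rewrite /vcons mxE; case: splitP => [j _|j /= h]; last by [].
by rewrite ord1 mxE eqxx mulr1n.
Qed.

Lemma vconsS n a (y : 'rV[R]_n) j : vcons a y 0 (lift ord0 j) = y 0 j.
Proof.
have -> : lift ord0 j = rshift 1 j by exact: val_inj.
by rewrite /vcons (row_mxEr (a%:M : 'rV[R]_1)).
Qed.

Lemma vconsP n (x : 'rV[R]_n.+1) : x = vcons (x 0 ord0) (\row_j x 0 (lift ord0 j)).
Proof.
apply/rowP => i; case: (unliftP ord0 i) => [j ->|->]; last by rewrite vcons0.
by rewrite vconsS mxE.
Qed.

Lemma box_vcons s n a (y : 'rV[R]_n) :
  box s (vcons a y) <-> `|a| <= s / 2 /\ box s y.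
Proof.
split=> [h|[h1 h2] i].
  split; first by have := h ord0; rewrite vcons0.
  by move=> i; have := h (lift ord0 i); rewrite vconsS.
by case: (unliftP ord0 i) => [j ->|->]; rewrite ?vcons0 ?vconsS.
Qed.

Lemma cube_intS s n (h : 'rV[R]_n.+1 -> R) :
  cube_int s h = seg_int s (fun a => cube_int s (fun y => h (vcons a y))).
Proof. by []. Qed.

Lemma row_continuous (T : topologicalType) n (f : T -> 'rV[R]_n) :
  (forall i, continuous (fun t => f t 0 i)) -> continuous f.
Proof.
move=> fc t A [P Pn PA].
rewrite /nbhs /= /nbhs /=.
have : \forall t' \near t, forall i, P 0 i (f t' 0 i).
  apply: filter_forall => i; apply: (fc i t); exact: Pn.
apply: filterS => t' h; apply: PA => i j; rewrite (ord1 i); exact: h.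
Qed.

Lemma vcons_continuous n : continuous (fun p : R * 'rV[R]_n => vcons p.1 p.2).
Proof.
apply: row_continuous => i; case: (unliftP ord0 i) => [j ->|->].
  have -> : (fun t : R * 'rV[R]_n => vcons t.1 t.2 0 (lift ord0 j)) =
    (fun y : 'rV[R]_n => y 0 j) \o snd by apply/funext => t; rewrite vconsS.
  by move=> t; apply: continuous_comp; [exact: cvg_snd|exact: coord_continuous].
have -> : (fun t : R * 'rV[R]_n => vcons t.1 t.2 0 ord0) = fst.
  by apply/funext => t; rewrite vcons0.
by move=> t; exact: cvg_fst.
Qed.

Lemma pair_continuousr (T U : topologicalType) (t : T) :
  continuous (fun u : U => (t, u)).
Proof.
move=> u A [[P Q] /= [nP nQ] PQ]; apply: filterS nQ => v Qv.
by apply: PQ; split => //=; exact: nbhs_singleton nP.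
Qed.

Lemma slice_continuous n (h : 'rV[R]_n.+1 -> R) a : continuous h ->
  continuous (fun y => h (vcons a y)).
Proof.
move=> ch y; apply: (@continuous_comp _ _ _ (fun y => vcons a y) h); last exact: ch.
apply: (@continuous_comp _ _ _ (fun y => (a, y)) (fun p => vcons p.1 p.2)).
  exact: pair_continuousr.
exact: vcons_continuous.
Qed.

Lemma box_compact s n : compact (@box s n).
Proof.
have -> : @box s n = [set v | forall i, `[- (s / 2), s / 2]%classic (v ord0 i)].
  apply/seteqP; split => x h i /=; have := h i;
  by rewrite /= in_itv /= ler_norml.
apply: (@rV_compact R n (fun=> `[- (s / 2), s / 2]%classic)) => i.
exact: segment_compact.
Qed.

(** The tube lemma for the compact cube: continuity in the parameter is uniform
    on the cube. *)
Lemma tube (T : topologicalType) s n (H : T -> 'rV[R]_n -> R) (t : T) e :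
  continuous (fun p : T * 'rV[R]_n => H p.1 p.2) -> 0 < e ->
  \forall t' \near t, forall y, box s y -> `|H t' y - H t y| <= e.
Proof.
move=> cH e0.
have /compact_near_coveringP K := @box_compact s n.
apply: (K T (nbhs t) (fun t' y => `|H t' y - H t y| <= e)) => y _.
have e20 : 0 < e / 2 by rewrite divr_gt0.
have /cvgrPdist_le/(_ (e / 2) e20) [[U V] /= [nU nV] UV] := cH (t, y).
exists (V, U) => //= -[y' t'] [/= Vy' Ut'].
have h1 := UV (t', y') (conj Ut' Vy').
have h2 := UV (t, y') (conj (nbhs_singleton nU) Vy').
rewrite /= in h1 h2.
move: h1 h2; rewrite !ler_norml => /andP[? ?] /andP[? ?]; apply/andP; split; lra.
Qed.

Lemma cube_int_ext s n (h h' : 'rV[R]_n -> R) :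
  (forall x, box s x -> h x = h' x) -> cube_int s h = cube_int s h'.
Proof.
elim: n h h' => [|n IH] h h' hh'; first by apply: hh' => -[].
rewrite !cube_intS; apply: seg_int_ext => a ha; apply: IH => y hy.
by apply: hh'; apply/box_vcons.
Qed.

(** Linearity and the supremum bound in dimension [n + 1] require the inner
    integral to be continuous in the outer variable, which in turn follows from
    both of them in dimension [n]; they are therefore proved by one induction. *)
Definition cube_int_regular s n := forall (h h' : 'rV[R]_n -> R),
  continuous h -> continuous h' ->
  (forall k, cube_int s (fun x => h x + k * h' x) = cube_int s h + k * cube_int s h') /\
  (forall M, (forall x, box s x -> `|h x| <= M) -> `|cube_int s h| <= s ^+ n * M).

(** By [tube] the integrands at nearby parameters differ by a small constant on
    the whole cube. *)
Lemma cube_int_param_regular s n : cube_int_regular s n ->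
  forall (T : topologicalType) (H : T -> 'rV[R]_n -> R),
  0 <= s -> continuous (fun p : T * 'rV[R]_n => H p.1 p.2) ->
  continuous (fun t => cube_int s (H t)).
Proof.
move=> good T H s0 cH t.
have cHt t' : continuous (H t').
  move=> y; apply: (@continuous_comp _ _ _ (fun y => (t', y)) (fun p => H p.1 p.2)).
    exact: pair_continuousr.
  exact: cH.
apply/cvgrPdistC_le => e e0.
have k0 : 0 < s ^+ n + 1 by rewrite ltr_wpDl ?exprn_ge0.
have := tube s t cH (divr_gt0 e0 k0); apply: filterS => t' ht'.
have [lin _] := good _ _ (cHt t') (cHt t).
have -> : cube_int s (H t') - cube_int s (H t) =
  cube_int s (fun y => H t' y + (-1) * H t y) by rewrite lin; ring.
have cD : continuous (fun y => H t' y + (-1) * H t y).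
  exact: addf_continuous (cHt t') (mulf_continuous (@cst_continuous _ _ _) (cHt t)).
have [_ bd] := good _ _ cD cD.
apply: (@le_trans _ _ (s ^+ n * (e / (s ^+ n + 1)))).
  apply: bd => y hy; rewrite mulN1r; exact: ht'.
rewrite mulrCA ger_pMr // ler_pdivrMr //; lra.
Qed.

Lemma cube_int_regularity s n : 0 <= s -> cube_int_regular s n.
Proof.
move=> s0; elim: n => [|n IH] h h' ch ch'.
  split=> [k //|M]; rewrite expr0 mul1r /=; apply => -[] //.
have cI (g : 'rV[R]_n.+1 -> R) : continuous g ->
    continuous (fun a => cube_int s (fun y => g (vcons a y))).
  move=> cg; apply: (cube_int_param_regular IH) => // p.
  apply: (@continuous_comp _ _ _ (fun p : R * 'rV[R]_n => vcons p.1 p.2) g).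
    exact: vcons_continuous.
  exact: cg.
split=> [k|M hM].
  rewrite !cube_intS -seg_int_lin; try exact: cI.
  apply: seg_int_ext => a _.
  by have [-> _] := IH _ _ (slice_continuous (a := a) ch) (slice_continuous (a := a) ch').
rewrite cube_intS exprS -mulrA; apply: seg_int_bound => //; first exact: cI.
move=> a ha.
have [_ bd] := IH _ _ (slice_continuous (a := a) ch) (slice_continuous (a := a) ch).
by apply: bd => y hy; apply: hM; apply/box_vcons.
Qed.

Lemma cube_int_param s n (T : topologicalType) (H : T -> 'rV[R]_n -> R) :
  0 <= s -> continuous (fun p : T * 'rV[R]_n => H p.1 p.2) ->
  continuous (fun t => cube_int s (H t)).
Proof. by move=> s0; apply: cube_int_param_regular => //; exact: cube_int_regularity. Qed.

Lemma cube_int_lin s n (h h' : 'rV[R]_n -> R) k : 0 <= s ->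
  continuous h -> continuous h' ->
  cube_int s (fun x => h x + k * h' x) = cube_int s h + k * cube_int s h'.
Proof. by move=> s0 ch ch'; have [-> _] := cube_int_regularity s0 ch ch'. Qed.

Lemma cube_int_bound s n (h : 'rV[R]_n -> R) M : 0 <= s ->
  continuous h -> (forall x, box s x -> `|h x| <= M) ->
  `|cube_int s h| <= s ^+ n * M.
Proof. by move=> s0 ch; have [_] := cube_int_regularity s0 ch ch; apply. Qed.

Lemma cube_int_cst s n k : 0 <= s -> cube_int s (fun _ : 'rV[R]_n => k) = k * s ^+ n.
Proof.
move=> s0; elim: n => [|n IH]; first by rewrite mulr1.
rewrite cube_intS IH seg_int_cst // exprSr mulrA //.
Qed.

Lemma cube_intZ s n (h : 'rV[R]_n -> R) k : 0 <= s -> continuous h ->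
  cube_int s (fun x => k * h x) = k * cube_int s h.
Proof.
move=> s0 ch; have := @cube_int_lin s n (fun=> 0) h k s0 (@cst_continuous _ _ _) ch.
rewrite cube_int_cst // mul0r add0r => <-.
by apply: cube_int_ext => x _; rewrite add0r.
Qed.

Lemma cube_intD s n (h h' : 'rV[R]_n -> R) : 0 <= s -> continuous h -> continuous h' ->
  cube_int s (fun x => h x + h' x) = cube_int s h + cube_int s h'.
Proof.
move=> s0 ch ch'; rewrite -[in RHS](mul1r (cube_int s h')) -cube_int_lin //.
by apply: cube_int_ext => x _; rewrite mul1r.
Qed.

Lemma cube_intB s n (h h' : 'rV[R]_n -> R) : 0 <= s -> continuous h -> continuous h' ->
  cube_int s (fun x => h x - h' x) = cube_int s h - cube_int s h'.
Proof.
move=> s0 ch ch'; rewrite -mulN1r -cube_int_lin //.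
by apply: cube_int_ext => x _; rewrite mulN1r.
Qed.

End CubeIntegral.

(** * Directional derivatives *)

Section DirectionalDerivative.
Context {R : realType}.

(** A directional derivative depends only on the restriction of the function to
    the line through the point. *)
Lemma is_derive_transfer (V W : normedModType R) (f : V -> R) (g : W -> R)
    x v y w d : (forall t : R, g (y + t *: w) = f (x + t *: v)) ->
  is_derive x v f d -> is_derive y w g d.
Proof.
move=> gf [fd <-].
have gf0 : g y = f x by have := gf 0; rewrite !scale0r !addr0.
have E : (fun t : R => t^-1 *: ((g \o shift y) (t *: w) - g y)) =
         (fun t : R => t^-1 *: ((f \o shift x) (t *: v) - f x)).
  by apply/funext => t; rewrite /= gf0 [_ *: w + _]addrC gf [_ *: v + _]addrC.
have dE : derivable g y w = derivable f x v.
  by rewrite /derivable E.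
have vE : 'D_w g y = 'D_v f x by rewrite /derive E.
by split; rewrite ?dE ?vE.
Qed.

Lemma is_derive_line (V : normedModType R) (f : V -> R) x v (a : R) d :
  is_derive (x + a *: v) v f d -> is_derive a (1 : R) (fun t => f (x + t *: v)) d.
Proof.
by apply: is_derive_transfer => t; rewrite scalerDl addrA [t *: 1]mulr1.
Qed.

Lemma is_derive_eps (V : normedModType R) (f : V -> R) x v d :
  (forall e, 0 < e -> exists2 r, 0 < r & forall t, `|t| < r ->
     `|f (x + t *: v) - f x - t * d| <= e * `|t|) ->
  is_derive x v f d.
Proof.
move=> H.
have cv : (fun t : R => t^-1 *: ((f \o shift x) (t *: v) - f x)) @ 0^' --> d.
  apply/cvgrPdistC_le => e e0; have [r r0 rH] := H e e0.
  near=> t.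
  have t0 : t != 0 by near: t; exact: nbhs_dnbhs_neq.
  have tr : `|t| < r by near: t; apply: dnbhs0_lt.
  have := rH t tr; rewrite /= [_ + x]addrC => h.
  have -> : t^-1 *: (f (x + t *: v) - f x) - d =
            t^-1 * (f (x + t *: v) - f x - t * d).
    by rewrite [_ *: _]mulrC mulrBr mulKf // mulrC.
  by rewrite normrM normfV mulrC ler_pdivrMr ?normr_gt0.
split; first by apply/cvg_ex; exists d.
exact: cvg_lim.
Unshelve. all: by end_near.
Qed.

Lemma mvt_bound (psi dpsi : R -> R) (a t M : R) :
  (forall c, is_derive c (1 : R) psi (dpsi c)) ->
  (forall c, `|c - a| <= `|t| -> `|dpsi c| <= M) ->
  `|psi (a + t) - psi a| <= M * `|t|.
Proof.
move=> dP bM.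
have cpsi : continuous psi.
  move=> c; apply: differentiable_continuous; apply/derivable1_diffP.
  by have [] := dP c.
have [t0|t0] := leP 0 t.
  have le : a <= a + t by rewrite lerDl.
  have [c] := MVT_segment le (fun c _ => dP c) (continuous_subspaceT cpsi).
  rewrite in_itv /= => /andP[h1 h2] ->; rewrite normrM addrC addKr.
  by rewrite ler_wpM2r // bM // (ger0_norm t0) ger0_norm; lra.
have le : a + t <= a by rewrite gerDl ltW.
have [c] := MVT_segment le (fun c _ => dP c) (continuous_subspaceT cpsi).
rewrite in_itv /= => /andP[h1 h2] E; rewrite distrC E normrM.
rewrite opprD addNKr normrN ler_wpM2r // bM // (ltr0_norm t0) ler_norml.
by apply/andP; split; lra.
Qed.

(** The mean value inequality for [phi] minus its linearization at [a]. *)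
Lemma mvt_taylor (phi dphi : R -> R) (a t e : R) :
  (forall c, is_derive c (1 : R) phi (dphi c)) ->
  (forall c, `|c - a| <= `|t| -> `|dphi c - dphi a| <= e) ->
  `|phi (a + t) - phi a - t * dphi a| <= e * `|t|.
Proof.
move=> dP be.
have dpsi c : is_derive c (1 : R) (fun x => phi x - x * dphi a) (dphi c - dphi a).
  have h1 := is_deriveM (is_derive_id c (1 : R)) (is_derive_cst (dphi a) c (1 : R)).
  have h2 := is_deriveB (dP c) h1.
  by apply: is_derive_eq h2 _; rewrite /= scaler0 add0r [_ *: 1]mulr1.
have := mvt_bound dpsi be.
by have -> : phi (a + t) - (a + t) * dphi a - (phi a - a * dphi a) =
             phi (a + t) - phi a - t * dphi a by ring.
Qed.

End DirectionalDerivative.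

(** * Differentiation under the integral and integration by parts *)

Section CubeDerivative.
Context {R : realType}.
Variables (s : R) (s0 : 0 < s).

Lemma mxlineE n (x v : 'rV[R]_n) t i : (x + t *: v) 0 i = x 0 i + t * v 0 i.
Proof. by rewrite !mxE. Qed.

Lemma vconsD0 n (a t : R) (y : 'rV[R]_n) :
  vcons (a + t) y = vcons a y + t *: delta_mx 0 ord0.
Proof.
apply/rowP => i; rewrite mxlineE [delta_mx _ _ _ _]mxE eqxx /=.
case: (unliftP ord0 i) => [j ->|->]; first by rewrite !vconsS mulr0 addr0.
by rewrite !vcons0 mulr1.
Qed.

Lemma vconsDS n (a t : R) (y : 'rV[R]_n) j :
  vcons a (y + t *: delta_mx 0 j) = vcons a y + t *: delta_mx 0 (lift ord0 j).
Proof.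
apply/rowP => i; rewrite mxlineE [delta_mx _ _ _ _]mxE eqxx /=.
case: (unliftP ord0 i) => [k ->|->]; last by rewrite !vcons0 mulr0 addr0.
by rewrite !vconsS mxlineE [delta_mx _ _ _ _]mxE eqxx /= (inj_eq (lift_inj (h:=ord0))).
Qed.

Lemma uncurry_continuous n (h : 'rV[R]_n.+1 -> R) : continuous h ->
  continuous (fun p : R * 'rV[R]_n => h (vcons p.1 p.2)).
Proof.
move=> ch p; apply: (@continuous_comp _ _ _ (fun p : R * 'rV[R]_n => vcons p.1 p.2) h).
  exact: vcons_continuous.
exact: ch.
Qed.

(** By the mean value inequality the error of the difference quotient is at most
    the oscillation of [dh] in the first variable, which [tube] makes small on the
    whole cube. *)
Lemma cube_int_derive n (h dh : 'rV[R]_n.+1 -> R) (a : R) :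
  continuous h -> continuous dh ->
  (forall x, is_derive x (delta_mx 0 ord0) h (dh x)) ->
  is_derive a (1 : R) (fun a => cube_int s (fun y => h (vcons a y)))
    (cube_int s (fun y => dh (vcons a y))).
Proof.
move=> ch cdh dP; apply: is_derive_eps => e e0.
have k0 : 0 < s ^+ n + 1 by rewrite ltr_wpDl ?exprn_ge0 // ltW.
have := @tube R _ s n (fun a y => dh (vcons a y)) a _ (uncurry_continuous cdh)
  (divr_gt0 e0 k0).
move/nbhs_ballP => [r /= r0 rH]; exists r => // t tr.
have s0' := ltW s0.
rewrite [t *: 1]mulr1.
have cs a' := slice_continuous (a := a') ch.
have cds := slice_continuous (a := a) cdh.
have -> : cube_int s (fun y => h (vcons (a + t) y)) -
    cube_int s (fun y => h (vcons a y)) - t * cube_int s (fun y => dh (vcons a y))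
  = cube_int s (fun y => h (vcons (a + t) y) - h (vcons a y) - t * dh (vcons a y)).
  rewrite cube_intB //; last 2 first.
  - exact: subf_continuous.
  - exact: mulf_continuous (@cst_continuous _ _ _) cds.
  by rewrite cube_intB // cube_intZ.
apply: (@le_trans _ _ (s ^+ n * (e / (s ^+ n + 1) * `|t|))).
  apply: cube_int_bound => //.
    apply: subf_continuous; first exact: subf_continuous.
    exact: mulf_continuous (@cst_continuous _ _ _) cds.
  move=> y yb.
  have dl c : is_derive c (1 : R) (fun a => h (vcons a y)) (dh (vcons c y)).
    apply: is_derive_transfer (dP (vcons c y)) => u.
    by rewrite [u *: 1]mulr1 vconsD0.
  apply: (mvt_taylor dl) => c hc; apply: rH => //=.
  by rewrite /ball /= distrC; apply: le_lt_trans tr.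
rewrite mulrA; apply: ler_wpM2r => //.
by rewrite mulrCA ger_pMr // ler_pdivrMr //; lra.
Qed.

(** Applied to a product of periodic functions this is integration by parts.
    If [i] is the outermost variable, differentiate under the inner integral and use
    the fundamental theorem of calculus; the boundary terms agree by periodicity.
    Otherwise the inner integral already vanishes. *)
Lemma cube_int_deriv0 n (i : 'I_n) (h dh : 'rV[R]_n -> R) :
  continuous h -> continuous dh ->
  (forall x, is_derive x (delta_mx 0 i) h (dh x)) ->
  (forall x, h (x + s *: delta_mx 0 i) = h x) ->
  cube_int s dh = 0.
Proof.
elim: n i h dh => [[]//|n IH] i h dh ch cdh dP per.
case: (unliftP ord0 i) => [j ij|i0]; rewrite cube_intS.
  rewrite (seg_int_ext (psi := fun=> 0)) ?seg_int_cst ?mul0r ?ltW // => a _.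
  apply: (IH j (fun y => h (vcons a y))).
  - exact: slice_continuous.
  - exact: slice_continuous.
  - move=> y; apply: is_derive_transfer (dP (vcons a y)) => t.
    by rewrite vconsDS ij.
  - by move=> y; rewrite vconsDS -ij.
rewrite i0 in dP per.
have cPhi : continuous (fun a => cube_int s (fun y => dh (vcons a y))).
  by apply: cube_int_param; [exact: ltW|exact: uncurry_continuous].
rewrite (seg_int_FTC s0 cPhi (fun a => @cube_int_derive _ h dh a ch cdh dP)).
apply/eqP; rewrite subr_eq0; apply/eqP; apply: cube_int_ext => y _.
by rewrite -[in RHS]per -vconsD0; congr (h (vcons _ _)); lra.
Qed.

End CubeDerivative.

(** * Uniqueness of Fourier coefficients *)

Section Frequency.
Context {R : realType}.
Variables (s w : R) (s0 : 0 < s) (ws : `|w| * s = pi *+ 2).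

Lemma freq_neq0 : w != 0.
Proof.
apply/eqP => w0; move: ws; rewrite w0 normr0 mul0r => /esym/eqP.
by rewrite mulrn_eq0 /= gt_eqF // pi_gt0.
Qed.

Lemma cos_freq : cos (w * s) = 1.
Proof. by rewrite -(cos_norm (w * s)) normrM (gtr0_norm s0) ws cos2pi. Qed.

Lemma sin_freq : sin (w * s) = 0.
Proof. by apply: cos1sin0; rewrite cos_freq normr1. Qed.

Lemma cis_freq_int (p : int) : cis (p%:~R * (w * s)) = 1.
Proof.
have natE (q : nat) : cis (q%:R * (w * s)) = 1.
  elim: q => [|q IH]; first by rewrite mul0r cis0.
  by rewrite -natr1 mulrDl mul1r cisD IH mul1r /cis cos_freq sin_freq.
case: p => q; first exact: natE.
rewrite NegzE mulrNz mulNr; have := natE q.+1.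
by rewrite /cis cosN sinN -[q.+1%:~R]/(q.+1%:R) => -[-> ->]; rewrite oppr0.
Qed.

End Frequency.

Section FourierUniqueness1.
Context {R : realType}.
Variables (s w : R) (s0 : 0 < s) (ws : `|w| * s = pi *+ 2).

Lemma linear_continuous (c : R) : continuous (fun y : R => c * y).
Proof. exact: mulf_continuous (@cst_continuous _ _ _) (fun y => @cvg_id _ _). Qed.

Lemma comp_continuous1 (T : topologicalType) (f : R -> R) (g : T -> R) :
  continuous f -> continuous g -> continuous (fun y => f (g y)).
Proof. by move=> cf cg y; apply: (@continuous_comp _ _ _ g f); [exact: cg|exact: cf]. Qed.

Lemma expf_continuous (T : topologicalType) (f : T -> R) N :
  continuous f -> continuous (fun y => f y ^+ N).
Proof.
move=> cf; elim: N => [|N IH]; first exact: cst_continuous.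
by under eq_fun do rewrite exprS; exact: mulf_continuous.
Qed.

Lemma cosw_continuous (c e : R) : continuous (fun y : R => cos (c * (y - e))).
Proof.
apply: comp_continuous1; first exact: continuous_cos.
apply: mulf_continuous; first exact: cst_continuous.
by apply: subf_continuous; [move=> y; exact: cvg_id|exact: cst_continuous].
Qed.

Lemma trig_freq_continuous (m : int) :
  continuous (fun y : R => cos (m%:~R * (w * y))) /\
  continuous (fun y : R => sin (m%:~R * (w * y))).
Proof.
have cl : continuous (fun y : R => m%:~R * (w * y)).
  by apply: mulf_continuous; [exact: cst_continuous|exact: linear_continuous].
by split; apply: comp_continuous1 cl; [exact: continuous_cos|exact: continuous_sin].
Qed.

Section Peak.
Variable x : R.

(** This is [cos^2 (w (y - x) / 2)]: its powers are trigonometric polynomials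
    that concentrate at the points congruent to [x]. *)
Definition peak (y : R) : R := (1 + cos (w * (y - x))) / 2.

Lemma peak_continuous : continuous peak.
Proof.
apply: mulf_continuous; last exact: cst_continuous.
by apply: addf_continuous; [exact: cst_continuous|exact: cosw_continuous].
Qed.

Lemma peak_ge0 y : 0 <= peak y.
Proof. by rewrite divr_ge0 // -lerBlDl sub0r cos_geN1. Qed.

Lemma peak_le1 y : peak y <= 1.
Proof. by rewrite /peak; have := cos_le1 (w * (y - x)); lra. Qed.

Definition peak_mass N : R := seg_int s (fun y => peak y ^+ N).

(** With [q] for the peak, [cos = 2 q - 1] and [sin^2 = 4 q (1 - q)]. *)
Lemma peak_power_derive N (y : R) :
  is_derive y (1 : R) (fun y => sin (w * (y - x)) * peak y ^+ N)
   (w * ((2 * N%:R + 2) * peak y ^+ N.+1 - (2 * N%:R + 1) * peak y ^+ N)).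
Proof.
have dl : is_derive y (1 : R) (fun y => w * (y - x)) w.
  apply: is_derive_eq.
  by rewrite subr0 [_ *: _]mulr1.
have dq : is_derive y (1 : R) peak (- (w * sin (w * (y - x))) / 2).
  rewrite /peak; apply: is_derive_eq.
  by rewrite scaler0 !add0r /GRing.scale /=; ring.
have dX : is_derive y (1 : R) (fun y => peak y ^+ N)
    (N%:R * peak y ^+ N.-1 * (- (w * sin (w * (y - x))) / 2)).
  have -> : (fun y => peak y ^+ N) = (peak : R -> R) ^+ N.
    by apply/funext => z; rewrite exprfctE.
  by apply: is_derive_eq (is_deriveX N dq) _.
apply: is_derive_eq.
rewrite /GRing.scale /=.
set c := cos _; set si := sin _; set q := peak y.
have ce : c = 2 * q - 1 by rewrite /q /peak -/c; field.
have se : si * si = 4 * q * (1 - q).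
  by rewrite -expr2 /si sin2cos2 -/c ce; ring.
clear dX dq dl; case: N => [|N]; first by rewrite ce; ring.
have -> : q ^+ N.+1.-1 = q ^+ N by [].
rewrite !exprS -[N.+1%:R]natr1 ce.
set k := N%:R; set Q := q ^+ N.
transitivity (- w * (k + 1) * Q / 2 * (si * si) + w * q * Q * (2 * q - 1)); first by field.
by rewrite se; field.
Qed.

(** The integral of the derivative in [peak_power_derive] over a period is zero.
    Consequently the ratio of consecutive masses tends to 1. *)
Lemma peak_massS N :
  (2 * N%:R + 2) * peak_mass N.+1 = (2 * N%:R + 1) * peak_mass N.
Proof.
have cq k := expf_continuous (N := k) peak_continuous.
have cz (k : R) M : continuous (fun y => k * peak y ^+ M).
  exact: mulf_continuous (@cst_continuous _ _ _) (cq M).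
have := @seg_int_FTC R s _ _ s0 _ (peak_power_derive N).
have cB : continuous (fun y =>
    (2 * N%:R + 2) * peak y ^+ N.+1 - (2 * N%:R + 1) * peak y ^+ N).
  exact: subf_continuous.
move=> /(_ (mulf_continuous (@cst_continuous _ _ w) cB)).
rewrite seg_intZ; last exact: subf_continuous.
rewrite seg_intB // !seg_intZ // => E.
have per : sin (w * (s / 2 - x)) * peak (s / 2) ^+ N =
           sin (w * (- (s / 2) - x)) * peak (- (s / 2)) ^+ N.
  have [E1 E2] : sin (w * (s / 2 - x)) = sin (w * (- (s / 2) - x)) /\
                 cos (w * (s / 2 - x)) = cos (w * (- (s / 2) - x)).
    have -> : w * (s / 2 - x) = w * (- (s / 2) - x) + w * s by field.
    by rewrite cosD sinD (cos_freq s0 ws) (sin_freq s0 ws); split; ring.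
  by rewrite /peak E1 E2.
move: E; rewrite per subrr => /eqP.
by rewrite mulf_eq0 (negbTE (freq_neq0 ws)) /= subr_eq0 => /eqP.
Qed.

Lemma peak_mass_gt0 N : 0 < peak_mass N.
Proof.
elim: N => [|N IH].
  by rewrite /peak_mass (seg_int_ext (psi := fun=> 1)) ?seg_int_cst ?mul1r ?ltW.
have := peak_massS N.
have : 0 <= N%:R :> R by [].
nra.
Qed.

(** The phase [|w| |y - x|] stays between [|w| r] and [2 pi - |w| r], where the
    cosine is at most its value at the ends. *)
Lemma peak_away (r : R) : 0 < r -> r + `|x| <= s / 2 -> exists2 c, 0 < c &
  forall y, `|y| <= s / 2 -> r <= `|y - x| -> c <= 1 - peak y.
Proof.
move=> r0 rx.
have aw0 : 0 < `|w| by rewrite normr_gt0 (freq_neq0 ws).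
have wr0 : 0 < `|w| * r by rewrite mulr_gt0.
have ws2 : `|w| * (s / 2) = pi by rewrite mulrA ws; field.
have wrpi : `|w| * r <= pi.
  by rewrite -ws2 ler_wpM2l //; have := normr_ge0 x; lra.
have c1 : cos (`|w| * r) < 1.
  rewrite -cos0 ltr_cos //; rewrite in_itv /= ?lexx ?pi_ge0 //.
  by rewrite (ltW wr0) wrpi.
exists ((1 - cos (`|w| * r)) / 2); first lra.
move=> y ys ry.
have -> : 1 - peak y = (1 - cos (w * (y - x))) / 2 by rewrite /peak; field.
rewrite ler_pM2r ?invr_gt0 // lerD2l lerN2.
rewrite -(cos_norm (w * _)) normrM.
set t := `|w| * `|y - x|.
have rt : `|w| * r <= t by rewrite ler_wpM2l.
have ts : t <= pi *+ 2 - `|w| * r.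
  rewrite -ws -mulrBr ler_wpM2l //.
  by have := ler_normB y x; lra.
have le_cos (p q : R) : 0 <= p -> p <= q -> q <= pi -> cos q <= cos p.
  move=> p0 pq qpi; rewrite leNgt ltr_cos ?in_itv /= ?p0 ?qpi ?andbT -?leNgt //.
    by rewrite (le_trans p0).
  by rewrite (le_trans pq).
have [tpi|pit] := leP t pi; first by apply: le_cos => //; exact: ltW.
have -> : cos t = cos (pi *+ 2 - t).
  by rewrite -[RHS]cosN opprB -[RHS]cosD2pi subrK.
apply: le_cos; [exact: ltW|lra|].
by rewrite mulr2n; lra.
Qed.

(** A Korovkin argument.  By continuity near [x] and [peak_away] elsewhere,
    [|d x - d y| <= e / 2 + M (1 - peak y)].  Integrating against [peak ^ N] bounds
    [|d x|] by [e / 2 + M (1 - J_(N+1) / J_N)], where [J_N] is the mass of [peak ^ N],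
    and the last term tends to 0 by [peak_massS]. *)
Lemma peak_moment_bound (d : R -> R) : continuous d -> `|x| < s / 2 ->
  (forall N, seg_int s (fun y => d y * peak y ^+ N) = 0) -> d x = 0.
Proof.
move=> cd xs H.
have s0' := s0.
have ltS : - (s / 2) <= s / 2 by lra.
apply/eqP; rewrite -normr_eq0 eq_le normr_ge0 andbT.
apply/ler_addgt0Pr => e e0; rewrite add0r.
have [r1 r10 r1H] : exists2 r, 0 < r & forall y, `|y - x| < r -> `|d y - d x| <= e / 2.
  have /cvgrPdist_le/(_ (e / 2) (divr_gt0 e0 (ltr0Sn R 1))) := cd x.
  move=> /nbhs_ballP[r /= r0 rH]; exists r => // y yr.
  by rewrite distrC; apply: rH; rewrite /ball /= distrC.
(* The second bound keeps the interval around x away from the points congruent to x. *)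
pose r := Num.min r1 (s / 2 - `|x|).
have r0 : 0 < r by rewrite lt_min r10 subr_gt0.
have [c c0 cH] : exists2 c, 0 < c &
    forall y, `|y| <= s / 2 -> r <= `|y - x| -> c <= 1 - peak y.
  by apply: peak_away => //; rewrite -lerBrDr ge_min lexx orbT.
have [B B0 BH] : exists2 B, 0 <= B & forall y, `|y| <= s / 2 -> `|d y| <= B.
  have cabs : continuous (fun y => `|d y|).
    by move=> y; apply: continuous_comp; [exact: cd|exact: norm_continuous].
  have [z _ zH] := EVT_max ltS (continuous_subspaceT cabs).
  exists `|d z| => // y ys; apply: zH.
  by rewrite in_itv /= -ler_norml.
pose M := 2 * B / c.
have M0 : 0 <= M by rewrite divr_ge0 ?mulr_ge0 // ltW.
have loc y : `|y| <= s / 2 -> `|d x - d y| <= e / 2 + M * (1 - peak y).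
  move=> ys; have [ry|yr] := leP r `|y - x|.
    have h1 : 2 * B <= M * (1 - peak y).
      rewrite /M -mulrA ler_peMr ?mulr_ge0 // mulrC ler_pdivlMr // mul1r.
      exact: cH.
    have h2 := BH _ ys; have h3 := BH x (ltW xs).
    have := ler_normB (d x) (d y); lra.
  have h1 : `|d y - d x| <= e / 2.
    by apply: r1H; apply: lt_le_trans yr _; rewrite ge_min lexx.
  rewrite distrC; apply: le_trans h1 _; rewrite lerDl mulr_ge0 //.
  by rewrite subr_ge0 peak_le1.
have cq N := expf_continuous (N := N) peak_continuous.
have key N : `|d x| * peak_mass N <= (e / 2 + M / (2 * N%:R + 2)) * peak_mass N.
  have -> : `|d x| * peak_mass N = `|seg_int s (fun y => (d x - d y) * peak y ^+ N)|.
    rewrite (seg_int_ext (psi := fun y => d x * peak y ^+ N - d y * peak y ^+ N)); last first.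
      by move=> a _; rewrite mulrBl.
    rewrite seg_intB; last 2 first.
    - by apply: mulf_continuous; [exact: cst_continuous|exact: cq].
    - by apply: mulf_continuous; [exact: cd|exact: cq].
    rewrite H subr0 seg_intZ; last exact: cq.
    by rewrite normrM (gtr0_norm (peak_mass_gt0 N)).
  apply: (@le_trans _ _
    (seg_int s (fun y => (e / 2 + M) * peak y ^+ N - M * peak y ^+ N.+1))).
    have cl : continuous (fun y => (d x - d y) * peak y ^+ N).
      by apply: mulf_continuous (cq N); apply: subf_continuous cd; exact: cst_continuous.
    have cr : continuous (fun y => (e / 2 + M) * peak y ^+ N - M * peak y ^+ N.+1).
      by apply: subf_continuous; apply: mulf_continuous;
        try exact: cst_continuous; exact: cq.
    have pt y : `|y| <= s / 2 -> `|(d x - d y) * peak y ^+ N| <=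
        (e / 2 + M) * peak y ^+ N - M * peak y ^+ N.+1.
      move=> ys; rewrite normrM (ger0_norm (exprn_ge0 N (peak_ge0 y))).
      have -> : (e / 2 + M) * peak y ^+ N - M * peak y ^+ N.+1 =
         (e / 2 + M * (1 - peak y)) * peak y ^+ N by rewrite exprS; ring.
      by rewrite ler_wpM2r ?exprn_ge0 ?peak_ge0 ?loc.
    rewrite ler_norml; apply/andP; split; last first.
      by apply: seg_int_le => // y ys; have := pt y ys; rewrite ler_norml => /andP[].
    rewrite -mulN1r -seg_intZ //; apply: seg_int_le => //.
      by apply: mulf_continuous => //; exact: cst_continuous.
    by move=> y ys; have := pt y ys; rewrite ler_norml mulN1r => /andP[].
  rewrite seg_intB; last 2 first.
  - by apply: mulf_continuous; [exact: cst_continuous|exact: cq].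
  - by apply: mulf_continuous; [exact: cst_continuous|exact: cq].
  rewrite !seg_intZ // -/(peak_mass N) -/(peak_mass N.+1).
  have N2 : 0 < 2 * N%:R + 2 :> R by rewrite ltr_wpDl // mulr_ge0.
  have -> : peak_mass N.+1 = (2 * N%:R + 1) * peak_mass N / (2 * N%:R + 2).
    by rewrite -peak_massS mulrAC divff ?mul1r // gt_eqF.
  rewrite le_eqVlt; apply/orP; left; apply/eqP; field.
  by rewrite gt_eqF.
have [N NM] : exists N : nat, M / (2 * N%:R + 2) <= e / 2.
  have [N MN] : exists N : nat, 2 * M / e < N%:R.
    have h : 0 <= 2 * M / e := divr_ge0 (mulr_ge0 (ler0n R 2) M0) (ltW e0).
    by exists (Num.bound (2 * M / e)); exact: archi_boundP.
  exists N; have N2 : 0 < 2 * N%:R + 2 :> R by rewrite ltr_wpDl // mulr_ge0.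
  rewrite ler_pdivrMr //; move: MN; rewrite ltr_pdivrMr // => MN.
  have : 0 <= e * N%:R by rewrite mulr_ge0 // ltW.
  nra.
have := key N; rewrite ler_pM2r ?peak_mass_gt0 //; lra.
Qed.

End Peak.

(** The product-to-sum formulas write the moments of [d] against powers of the
    peak as combinations of its trigonometric moments.  [peak_moment_bound] applies at
    interior points; the endpoints follow by continuity. *)
Lemma fourier_unique1 (d : R -> R) : continuous d ->
  (forall m : int, seg_int s (fun y => d y * cos (m%:~R * (w * y))) = 0) ->
  (forall m : int, seg_int s (fun y => d y * sin (m%:~R * (w * y))) = 0) ->
  forall x, `|x| <= s / 2 -> d x = 0.
Proof.
move=> cd Hc Hs.
have cc m := (trig_freq_continuous m).1.
have cs m := (trig_freq_continuous m).2.
have moments x N (h : R -> R) : continuous h ->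
    (forall m : int, seg_int s (fun y => h y * cos (m%:~R * (w * y))) = 0) ->
    (forall m : int, seg_int s (fun y => h y * sin (m%:~R * (w * y))) = 0) ->
    seg_int s (fun y => h y * peak x y ^+ N) = 0.
  elim: N h => [|N IH] h ch hc hs.
    rewrite -[RHS](hc 0); apply: seg_int_ext => y _.
    by rewrite expr0 mulr0z mul0r cos0.
  have chc m := mulf_continuous ch (cc m).
  have chs m := mulf_continuous ch (cs m).
  have lin3 (c1 c2 c3 c4 c5 : R) (f1 f2 f3 f4 f5 : R -> R) :
      continuous f1 -> continuous f2 -> continuous f3 -> continuous f4 -> continuous f5 ->
      seg_int s f1 = 0 -> seg_int s f2 = 0 -> seg_int s f3 = 0 ->
      seg_int s f4 = 0 -> seg_int s f5 = 0 ->
      seg_int s (fun y => c1 * f1 y + c2 * f2 y + c3 * f3 y + c4 * f4 y + c5 * f5 y) = 0.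
    move=> k1 k2 k3 k4 k5 e1 e2 e3 e4 e5.
    have kz (c : R) (f : R -> R) : continuous f -> continuous (fun y => c * f y).
      by move=> kf; apply: mulf_continuous kf; exact: cst_continuous.
    have z1 := kz c1 _ k1; have z2 := kz c2 _ k2; have z3 := kz c3 _ k3.
    have z4 := kz c4 _ k4; have z5 := kz c5 _ k5.
    have p2 := addf_continuous z1 z2; have p3 := addf_continuous p2 z3.
    have p4 := addf_continuous p3 z4.
    do 4 (rewrite seg_intD; [|by []|by []]).
    by rewrite !seg_intZ // e1 e2 e3 e4 e5 !mulr0 !addr0.
  rewrite (seg_int_ext (psi := fun y => (h y * peak x y) * peak x y ^+ N)); last first.
    by move=> y _; rewrite exprS mulrA.
  have E m y : m%:~R * (w * y) + w * y = (m + 1)%:~R * (w * y) :> R.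
    by rewrite intrD mulrDl mul1r.
  have E' m y : m%:~R * (w * y) - w * y = (m - 1)%:~R * (w * y) :> R.
    by rewrite intrB mulrBl mul1r.
  apply: IH => [|m|m].
  - by apply: mulf_continuous => //; exact: peak_continuous.
  - rewrite -(lin3 (1/2) (cos (w * x) / 4) (cos (w * x) / 4)
       (sin (w * x) / 4) (- (sin (w * x) / 4)) _ _ _ _ _
       (chc m) (chc (m + 1)) (chc (m - 1)) (chs (m + 1)) (chs (m - 1))) //.
    apply: seg_int_ext => y _; rewrite -!E -!E' /peak mulrBr.
    move: (m%:~R * (w * y)) (w * y) => p u.
    by rewrite !cosB !sinB !cosD !sinD; field.
  - rewrite -(lin3 (1/2) (cos (w * x) / 4) (cos (w * x) / 4)
       (- (sin (w * x) / 4)) (sin (w * x) / 4) _ _ _ _ _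
       (chs m) (chs (m + 1)) (chs (m - 1)) (chc (m + 1)) (chc (m - 1))) //.
    apply: seg_int_ext => y _; rewrite -!E -!E' /peak mulrBr.
    move: (m%:~R * (w * y)) (w * y) => p u.
    by rewrite !cosB !sinB !cosD !sinD; field.
have inside x : `|x| < s / 2 -> d x = 0.
  by move=> xs; apply: (peak_moment_bound cd xs) => N; exact: moments.
move=> x xs; apply/eqP/negP => /negP dx.
have /cvgrPdist_lt/(_ `|d x|) := cd x.
rewrite normr_gt0 => /(_ dx) /nbhs_ballP [r /= r0 rH].
(* The point (1 - t) x is interior and within r of x, since t s / 2 < r. *)
pose t := r / (r + 2 * s).
have t0 : 0 < t by rewrite divr_gt0 // addr_gt0 // mulr_gt0.
have t1 : t < 1 by rewrite ltr_pdivrMr ?mul1r ?ltrDl ?mulr_gt0 // addr_gt0 // mulr_gt0.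
have dz : d (x * (1 - t)) = 0.
  apply: inside; rewrite normrM (@ger0_norm _ (1 - t)); last lra.
  have := normr_ge0 x; have : 0 < s := s0. have : 0 < t * s by rewrite mulr_gt0. nra.
suff xb : ball x r (x * (1 - t)) by have := rH _ xb; rewrite /= dz subr0 ltxx.
rewrite /ball /= mulrBr mulr1 opprB addrC subrK normrM (gtr0_norm t0).
apply: (@le_lt_trans _ _ (s / 2 * t)); first by rewrite ler_wpM2r // ltW.
rewrite /t mulrA ltr_pdivrMr ?addr_gt0 ?mulr_gt0 //.
have := mulr_gt0 r0 s0; have := mulr_gt0 r0 r0; nra.
Qed.

End FourierUniqueness1.

Section ComplexCubeIntegral.
Context {R : realType}.

Definition ccontinuous (T : topologicalType) (h : T -> R[i]) : Prop :=
  continuous (fun x => complex.Re (h x)) /\ continuous (fun x => complex.Im (h x)).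

Lemma ccontinuousM (T : topologicalType) (g h : T -> R[i]) :
  ccontinuous g -> ccontinuous h -> ccontinuous (fun x => g x * h x).
Proof.
move=> [g1 g2] [h1 h2]; split.
  under eq_fun do rewrite ReM.
  by apply: subf_continuous; exact: mulf_continuous.
under eq_fun do rewrite ImM.
by apply: addf_continuous; exact: mulf_continuous.
Qed.

Lemma ccontinuousD (T : topologicalType) (g h : T -> R[i]) :
  ccontinuous g -> ccontinuous h -> ccontinuous (fun x => g x + h x).
Proof.
move=> [g1 g2] [h1 h2]; split.
  by under eq_fun do rewrite ReD; exact: addf_continuous.
by under eq_fun do rewrite ImD; exact: addf_continuous.
Qed.

Lemma ccontinuousB (T : topologicalType) (g h : T -> R[i]) :
  ccontinuous g -> ccontinuous h -> ccontinuous (fun x => g x - h x).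
Proof.
move=> [g1 g2] [h1 h2]; split.
  by under eq_fun do rewrite ReB; exact: subf_continuous.
by under eq_fun do rewrite ImB; exact: subf_continuous.
Qed.

Lemma ccontinuous_cst (T : topologicalType) (c : R[i]) : ccontinuous (fun _ : T => c).
Proof. by split; exact: cst_continuous. Qed.

Lemma ccontinuous_cis (T : topologicalType) (th : T -> R) : continuous th ->
  ccontinuous (fun x => cis (th x)).
Proof.
move=> cth; split.
  by apply: comp_continuous1 cth; exact: continuous_cos.
by apply: comp_continuous1 cth; exact: continuous_sin.
Qed.

Lemma ccontinuous_comp (T U : topologicalType) (h : U -> R[i]) (f : T -> U) :
  continuous f -> ccontinuous h -> ccontinuous (fun x => h (f x)).
Proof.
move=> cf [h1 h2]; split => x.
  by apply: (@continuous_comp _ _ _ f (fun x => complex.Re (h x))); [exact: cf|exact: h1].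
by apply: (@continuous_comp _ _ _ f (fun x => complex.Im (h x))); [exact: cf|exact: h2].
Qed.

Lemma ccube_int_ext s n (h h' : 'rV[R]_n -> R[i]) :
  (forall x, box s x -> h x = h' x) -> ccube_int s h = ccube_int s h'.
Proof.
by move=> E; congr (_ +i* _); apply: cube_int_ext => x /E ->.
Qed.

Lemma ccube_intZ s n (h : 'rV[R]_n -> R[i]) c : 0 <= s -> ccontinuous h ->
  ccube_int s (fun x => h x * c) = ccube_int s h * c.
Proof.
move=> s0 [h1 h2]; apply: complexP; rewrite /ccube_int ?ReM ?ImM /=.
  rewrite [_ * complex.Re c]mulrC [_ * complex.Im c]mulrC -!cube_intZ // -cube_intB //.
  - by apply: cube_int_ext => x _; rewrite ReM; ring.
  - by apply: mulf_continuous => //; exact: cst_continuous.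
  - by apply: mulf_continuous => //; exact: cst_continuous.
rewrite [_ * complex.Re c]mulrC [_ * complex.Im c]mulrC -!cube_intZ // -cube_intD //.
- by apply: cube_int_ext => x _; rewrite ImM; ring.
- by apply: mulf_continuous => //; exact: cst_continuous.
- by apply: mulf_continuous => //; exact: cst_continuous.
Qed.

Lemma ccube_intB s n (h h' : 'rV[R]_n -> R[i]) : 0 <= s ->
  ccontinuous h -> ccontinuous h' ->
  ccube_int s (fun x => h x - h' x) = ccube_int s h - ccube_int s h'.
Proof.
move=> s0 [h1 h2] [h1' h2']; apply: complexP; rewrite /ccube_int ?ReB ?ImB /= -cube_intB //;
by apply: cube_int_ext => x _; rewrite ?ReB ?ImB.
Qed.

Lemma ccube_int_bound s n (h : 'rV[R]_n -> R[i]) M : 0 <= s ->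
  ccontinuous h -> (forall x, box s x -> norm1 (h x) <= M) ->
  norm1 (ccube_int s h) <= 2 * (s ^+ n * M).
Proof.
move=> s0 [h1 h2] hM.
have b1 := cube_int_bound s0 h1 (fun x xb => le_trans (Re_le_norm1 _) (hM x xb)).
have b2 := cube_int_bound s0 h2 (fun x xb => le_trans (Im_le_norm1 _) (hM x xb)).
by rewrite /norm1 /ccube_int /=; lra.
Qed.

Lemma dotD n (x y y' : 'rV[R]_n) (t : R) : dot x (y + t *: y') = dot x y + t * dot x y'.
Proof.
rewrite /dot big_distrr /= -big_split; apply: eq_bigr => i _.
by rewrite !mxE /=; ring.
Qed.

Lemma dot0r n (x : 'rV[R]_n) : dot x 0 = 0.
Proof. by rewrite /dot big1 // => i _; rewrite mxE mulr0. Qed.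

Lemma dot_delta n (v : 'rV[R]_n) i : dot v (delta_mx 0 i) = v 0 i.
Proof.
rewrite /dot (bigD1 i) //= big1 ?addr0; first by rewrite !mxE !eqxx mulr1.
by move=> j ji; rewrite !mxE (negbTE ji) andbF mulr0.
Qed.

Lemma dot_continuous n (v : 'rV[R]_n) : continuous (fun x : 'rV[R]_n => dot v x).
Proof.
apply: sumf_continuous => i; apply: mulf_continuous; first exact: cst_continuous.
exact: coord_continuous.
Qed.

Lemma wave_ccontinuous n (c : R) (v : 'rV[R]_n) :
  ccontinuous (fun x : 'rV[R]_n => cis (c * dot v x)).
Proof.
apply: ccontinuous_cis; apply: mulf_continuous; first exact: cst_continuous.
exact: dot_continuous.
Qed.

End ComplexCubeIntegral.

Section FourierUniqueness.
Context {R : realType}.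
Variables (s w : R) (s0 : 0 < s) (ws : `|w| * s = pi *+ 2).

Definition zcons n (z : int) (m : 'rV[int]_n) : 'rV[int]_n.+1 :=
  \row_i (if unlift ord0 i is Some j then m 0 j else z).

Lemma dot_vcons n z (m : 'rV[int]_n) a (y : 'rV[R]_n) :
  dot (zvec (zcons z m)) (vcons a y) = z%:~R * a + dot (zvec m) y.
Proof.
rewrite /dot big_ord_recl vcons0 !mxE unlift_none; congr (_ + _).
by apply: eq_bigr => i _; rewrite vconsS !mxE liftK.
Qed.

(** Slicing in the first variable: for fixed frequencies in the other variables
    the inner integral is a continuous function of the first variable all of whose
    Fourier coefficients vanish, so it is zero, and induction applies to the slices. *)
Lemma fourier_unique n (D : 'rV[R]_n -> R[i]) : ccontinuous D ->
  (forall m : 'rV[int]_n,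
     ccube_int s (fun x => D x * cis (- w * dot (zvec m) x)) = 0) ->
  forall x, box s x -> D x = 0.
Proof.
have s0' := ltW s0.
elim: n D => [|n IH] D cD H x xs.
  have := H 0; have -> : x = 0 by apply/rowP => -[].
  rewrite /ccube_int /=.
  have -> : dot (zvec 0) (0 : 'rV[R]_0) = 0 by rewrite /dot big_ord0.
  rewrite mulr0 cis0 mulr1; by case: (D 0).
rewrite (vconsP x) in xs *.
move: (x 0 ord0) (\row_j _) xs => a y /box_vcons [ha hy].
have cDa b : ccontinuous (fun y => D (vcons b y)).
  by case: cD => c1 c2; split; [exact: (slice_continuous c1)|exact: (slice_continuous c2)].
apply: (IH (fun y => D (vcons a y))) => // m.
pose E b := ccube_int s (fun y => D (vcons b y) * cis (- w * dot (zvec m) y)).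
have cE : ccontinuous E.
  have cI : ccontinuous (fun p : R * 'rV[R]_n =>
      D (vcons p.1 p.2) * cis (- w * dot (zvec m) p.2)).
    apply: ccontinuousM.
      by case: cD => c1 c2; split;
        [exact: (uncurry_continuous c1)|exact: (uncurry_continuous c2)].
    apply: (@ccontinuous_comp _ _ _ (fun y => cis (- w * dot (zvec m) y)) snd).
      by move=> p; exact: cvg_snd.
    exact: wave_ccontinuous.
  by case: cI => c1 c2; split; apply: cube_int_param.
have HE (z : int) : seg_int s (fun b => complex.Re (E b * cis (- (z%:~R * (w * b))))) = 0 /\
                seg_int s (fun b => complex.Im (E b * cis (- (z%:~R * (w * b))))) = 0.
  have slice b : ccube_int s (fun y =>
      D (vcons b y) * cis (- w * dot (zvec (zcons z m)) (vcons b y)))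
      = E b * cis (- (z%:~R * (w * b))).
    rewrite -ccube_intZ //; last by apply: ccontinuousM => //; exact: wave_ccontinuous.
    apply: ccube_int_ext => u _; rewrite dot_vcons -mulrA -cisD; congr (_ * cis _); ring.
  have := H (zcons z m).
  by move=> [h1 h2]; split; [rewrite -[RHS]h1|rewrite -[RHS]h2];
     apply: (@seg_int_ext R s) => b _; rewrite -slice.
have cc z := (trig_freq_continuous w z).1.
have cs z := (trig_freq_continuous w z).2.
case: (cE) => cE1 cE2.
have k1 z := mulf_continuous cE1 (cc z).
have k2 z := mulf_continuous cE1 (cs z).
have k3 z := mulf_continuous cE2 (cc z).
have k4 z := mulf_continuous cE2 (cs z).
have eqs z : [/\ seg_int s (fun b => complex.Re (E b) * cos (z%:~R * (w * b))) = 0,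
   seg_int s (fun b => complex.Im (E b) * sin (z%:~R * (w * b))) = 0,
   seg_int s (fun b => complex.Im (E b) * cos (z%:~R * (w * b))) = 0 &
   seg_int s (fun b => complex.Re (E b) * sin (z%:~R * (w * b))) = 0].
  have [h1 h2] := HE z; have [h3 h4] := HE (- z).
  have e1 : seg_int s (fun b => complex.Re (E b) * cos (z%:~R * (w * b))) +
            seg_int s (fun b => complex.Im (E b) * sin (z%:~R * (w * b))) = 0.
    rewrite -seg_intD // -[RHS]h1; apply: seg_int_ext => b _.
    by rewrite ReM /= cosN sinN; ring.
  have e2 : seg_int s (fun b => complex.Im (E b) * cos (z%:~R * (w * b))) -
            seg_int s (fun b => complex.Re (E b) * sin (z%:~R * (w * b))) = 0.
    rewrite -seg_intB // -[RHS]h2; apply: seg_int_ext => b _.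
    by rewrite ImM /= cosN sinN; ring.
  have e3 : seg_int s (fun b => complex.Re (E b) * cos (z%:~R * (w * b))) -
            seg_int s (fun b => complex.Im (E b) * sin (z%:~R * (w * b))) = 0.
    rewrite -seg_intB // -[RHS]h3; apply: seg_int_ext => b _.
    by rewrite ReM /= mulrNz mulNr opprK.
  have e4 : seg_int s (fun b => complex.Im (E b) * cos (z%:~R * (w * b))) +
            seg_int s (fun b => complex.Re (E b) * sin (z%:~R * (w * b))) = 0.
    rewrite -seg_intD // -[RHS]h4; apply: seg_int_ext => b _.
    by rewrite ImM /= mulrNz mulNr opprK; ring.
  by split; lra.
rewrite -/(E a).
have r0 : complex.Re (E a) = 0.
  by apply: (fourier_unique1 s0 ws cE1) => // z; have [] := eqs z.
have i0 : complex.Im (E a) = 0.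
  by apply: (fourier_unique1 s0 ws cE2) => // z; have [] := eqs z.
by apply: complexP.
Qed.

End FourierUniqueness.

(** * Heat series *)

Section UniformSeries.
Context {R : realType} {T : topologicalType} {n : nat}.
Variables (S : set T) (u : 'rV[int]_n -> T -> R[i]) (b : 'rV[int]_n -> R).
Hypotheses (db : dominating b) (cu : forall m, ccontinuous (u m)).
Hypothesis (ub : forall m z, S z -> norm1 (u m z) <= b m).

Lemma series_has_csum z : S z -> has_csum (fun m => u m z) (csum (fun m => u m z)).
Proof. by move=> Sz; apply: (dominated_csum db) => m; exact: ub. Qed.

(** A uniform limit of continuous functions. *)
Lemma uniform_limit_within (f : T -> R) (a : 'rV[int]_n -> T -> R) :
  (forall m, continuous (a m)) -> (forall m z, S z -> `|a m z| <= b m) ->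
  (forall z, S z -> has_rsum (fun m => a m z) (f z)) -> {within S, continuous f}.
Proof.
move=> ca ab af; apply/subspace_continuousP => z Sz.
apply/cvgrPdistC_le => e e0.
have e30 : 0 < e / 3 by rewrite divr_gt0.
have [A0 A0P] := dominated_uniform db e30.
have unif y : S y -> `|\sum_(m <- A0) a m y - f y| <= e / 3.
  by move=> Sy; apply: (A0P _ _ (fun m => ab m y Sy) (af y Sy)).
have cs : continuous (fun y => \sum_(m <- A0) a m y) by exact: sumf_continuous.
have /cvgrPdistC_le/(_ _ e30) := cs z.
rewrite near_withinE; apply: filterS => y hy Sy.
have := unif y Sy; have := unif z Sz; move: hy.
rewrite /from_subspace !ler_norml => /andP[? ?] /andP[? ?] /andP[? ?].
by apply/andP; split; lra.
Qed.

Lemma series_ccontinuous_within :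
  {within S, continuous (fun z => complex.Re (csum (fun m => u m z)))} /\
  {within S, continuous (fun z => complex.Im (csum (fun m => u m z)))}.
Proof.
split.
  apply: (@uniform_limit_within _ (fun m z => complex.Re (u m z))).
  - by move=> m; case: (cu m).
  - by move=> m z Sz; apply: le_trans (Re_le_norm1 _) (ub m Sz).
  - by move=> z Sz; case: (series_has_csum Sz).
apply: (@uniform_limit_within _ (fun m z => complex.Im (u m z))).
- by move=> m; case: (cu m).
- by move=> m z Sz; apply: le_trans (Im_le_norm1 _) (ub m Sz).
- by move=> z Sz; case: (series_has_csum Sz).
Qed.

End UniformSeries.

Section HeatModes.
Context {R : realType} {n : nat}.
Variables (kap w : R) (kap0 : 0 < kap).
Implicit Types (z v : R * 'rV[R]_n) (m : 'rV[int]_n) (c : 'rV[int]_n -> R[i]).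

Definition sqn m : R := dot (zvec m) (zvec m).

Lemma sqn_ge0 m : 0 <= sqn m.
Proof. by apply: sumr_ge0 => i _; rewrite -expr2 sqr_ge0. Qed.

(** A solution of the heat equation with conductivity [k] when [kap = k w^2]. *)
Definition heat_mode m z : R[i] :=
  (expR (- (kap * sqn m * z.1)))%:C * cis (w * dot (zvec m) z.2).

(** The factor by which the derivative along [v] multiplies [heat_mode m]. *)
Definition heat_symbol m v : R[i] := (- (kap * sqn m * v.1)) +i* (w * dot (zvec m) v.2).

Definition rapidC c : Prop := rapid (fun m => norm1 (c m)).

Definition heat_series c z : R[i] := csum (fun m => c m * heat_mode m z).

Lemma fstZ z v (t : R) : (z + t *: v).1 = z.1 + t * v.1.
Proof. by []. Qed.

Lemma pos_near z : 0 < z.1 -> \forall y \near z, 0 < y.1.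
Proof.
move=> z0; exists ([set a | 0 < a], setT) => /=; last by move=> y [].
split; last exact: filterT.
by apply: filterS (@Nlt_nbhsl R z.1 0 _) => [y|] /=; rewrite oppr_lt0.
Qed.

Lemma is_derive_affine (A B u : R) : is_derive u (1 : R) (fun t : R => A + t * B) B.
Proof.
apply: is_derive_eps => e e0; exists 1 => // t _.
rewrite [t *: 1]mulr1.
have -> : A + (u + t) * B - (A + u * B) - t * B = 0 by ring.
by rewrite normr0 mulr_ge0 // ltW.
Qed.

Lemma norm1_heat_mode m z : 0 <= z.1 -> norm1 (heat_mode m z) <= 2.
Proof.
move=> z0; apply: le_trans (norm1M _ _) _.
rewrite norm1_real ger0_norm ?expR_ge0 //.
apply: (@le_trans _ _ (1 * 2)); last by rewrite mul1r.
apply: ler_pM; rewrite ?expR_ge0 ?norm1_ge0 ?norm1_cis //.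
by rewrite -expR0 ler_expR oppr_le0 !mulr_ge0 ?sqn_ge0 // ltW.
Qed.

Lemma heat_mode_ccontinuous m : ccontinuous (heat_mode m).
Proof.
apply: ccontinuousM.
  split; last exact: cst_continuous.
  rewrite /=; apply: comp_continuous1; first exact: continuous_expR.
  have -> : (fun z : R * 'rV[R]_n => - (kap * sqn m * z.1)) =
      (fun z => - (kap * sqn m) * z.1).
    by apply/funext => z; rewrite mulNr.
  by apply: mulf_continuous; [exact: cst_continuous|move=> z; exact: cvg_fst].
apply: (@ccontinuous_comp _ _ _ (fun y => cis (w * dot (zvec m) y)) snd).
  by move=> p; exact: cvg_snd.
exact: wave_ccontinuous.
Qed.

Lemma rapidC_dominating c (k : R) : 0 <= k -> rapidC c ->
  dominating (fun m => k * norm1 (c m)).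
Proof.
move=> k0 /rapid_dominating/(dominatingZ k0).
by congr dominating; apply/funext => m; rewrite ger0_norm ?norm1_ge0.
Qed.

Lemma norm1_heat_term c m z : 0 <= z.1 -> norm1 (c m * heat_mode m z) <= 2 * norm1 (c m).
Proof.
move=> z0; apply: le_trans (norm1M _ _) _; rewrite mulrC.
by rewrite ler_wpM2r ?norm1_ge0 ?norm1_heat_mode.
Qed.

Lemma heat_series_has_csum c z : rapidC c -> 0 <= z.1 ->
  has_csum (fun m => c m * heat_mode m z) (heat_series c z).
Proof.
move=> rc z0; apply: (dominated_csum (rapidC_dominating (ler0n R 2) rc)) => m.
exact: norm1_heat_term.
Qed.

Lemma heat_series_continuous c : rapidC c ->
  {within half_space, continuous (fun z => complex.Re (heat_series c z))} /\
  {within half_space, continuous (fun z => complex.Im (heat_series c z))}.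
Proof.
move=> rc.
apply: (@series_ccontinuous_within _ _ _ half_space (fun m z => c m * heat_mode m z) _
   (rapidC_dominating (ler0n R 2) rc)).
  move=> m; apply: ccontinuousM; [exact: ccontinuous_cst|exact: heat_mode_ccontinuous].
by move=> m z z0; exact: norm1_heat_term.
Qed.

Lemma rapidC_mul_symbol c v : rapidC c -> rapidC (fun m => c m * heat_symbol m v).
Proof.
move=> rc.
have r1 : rapid (fun m => sqn m * norm1 (c m)).
  have := rapid_sum (index_enum 'I_n) (fun i => rapid_coord i (rapid_coord i rc)).
  apply: le_rapid => m; rewrite /sqn /dot big_distrl /=.
  by rewrite le_eqVlt; apply/orP; left; apply/eqP; congr `|_|;
     apply: eq_bigr => i _; rewrite !mxE mulrA.
have r2 : rapid (fun m => dot (zvec m) v.2 * norm1 (c m)).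
  have := rapid_sum (index_enum 'I_n) (fun i => rapidZ (v.2 0 i) (rapid_coord i rc)).
  apply: le_rapid => m; rewrite /dot big_distrl /=.
  by rewrite le_eqVlt; apply/orP; left; apply/eqP; congr `|_|;
     apply: eq_bigr => i _; rewrite !mxE; ring.
have r3 := rapidZ (kap * v.1) r1; have r4 := rapidZ w r2.
have abs (b : 'rV[int]_n -> R) : rapid b -> rapid (fun m => `|b m|).
  by apply: le_rapid => m; rewrite normr_id.
rewrite /rapidC; apply: le_rapid (rapidD (abs _ r3) (abs _ r4)) => m.
rewrite [X in X <= _]ger0_norm ?norm1_ge0 // [X in _ <= X]ger0_norm ?addr_ge0 //.
apply: le_trans (norm1M _ _) _.
rewrite /norm1 /heat_symbol /= -/(norm1 (c m)) mulrDr.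
by rewrite le_eqVlt; apply/orP; left; apply/eqP; rewrite normrN !normrM
  !(ger0_norm (norm1_ge0 _)); ring.
Qed.

Lemma heat_mode_line_derive m z v (a : R[i]) (u : R) :
  is_derive u (1 : R) (fun t => complex.Re (a * heat_mode m (z + t *: v)))
    (complex.Re (a * heat_symbol m v * heat_mode m (z + u *: v))).
Proof.
pose A := - (kap * sqn m * z.1); pose B := - (kap * sqn m * v.1).
pose P := w * dot (zvec m) z.2; pose Q := w * dot (zvec m) v.2.
have E t : heat_mode m (z + t *: v) = (expR (A + t * B))%:C * cis (P + t * Q).
  rewrite /heat_mode fstZ dotD; congr ((expR _)%:C * cis _); last by rewrite /P /Q; ring.
  by rewrite /A /B; ring.
have -> : (fun t => complex.Re (a * heat_mode m (z + t *: v))) =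
  (fun t => expR (A + t * B) *
     (complex.Re a * cos (P + t * Q) - complex.Im a * sin (P + t * Q))).
  apply/funext => t; rewrite E ReM.
  by rewrite [complex.Re (_ * cis _)]ReM [complex.Im (_ * cis _)]ImM /=; ring.
have dA : is_derive u (1 : R) (fun t => A + t * B) B by exact: is_derive_affine.
have dP : is_derive u (1 : R) (fun t => P + t * Q) Q by exact: is_derive_affine.
have de : is_derive u (1 : R) (fun t => expR (A + t * B)) (expR (A + u * B) * B).
  exact: (is_derive1_comp (is_derive_expR _) dA).
have dc : is_derive u (1 : R) (fun t => cos (P + t * Q)) (- sin (P + u * Q) * Q).
  exact: (is_derive1_comp (is_derive_cos _) dP).
have ds : is_derive u (1 : R) (fun t => sin (P + t * Q)) (cos (P + u * Q) * Q).
  exact: (is_derive1_comp (is_derive_sin _) dP).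
apply: is_derive_eq.
rewrite E ReM [complex.Re (a * _)]ReM [complex.Im (a * _)]ImM
  [complex.Re (_ * cis _)]ReM [complex.Im (_ * cis _)]ImM /= -/B -/Q.
rewrite /GRing.scale /=; ring.
Qed.

(** The condition on [t] keeps the segment in the half-space, where the modes
    are bounded; the remainder is then quadratic in [t] with a constant depending only
    on the coefficient and the symbol. *)
Lemma heat_mode_taylor m z v (a : R[i]) (t : R) : `|t| * `|v.1| <= z.1 ->
  `|complex.Re (a * heat_mode m (z + t *: v)) - complex.Re (a * heat_mode m z) -
     t * complex.Re (a * heat_symbol m v * heat_mode m z)|
  <= 2 * norm1 (a * heat_symbol m v * heat_symbol m v) * `|t| * `|t|.
Proof.
move=> tz.
have z0 : z + 0 *: v = z by rewrite scale0r addr0.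
have d1 (c : R) := heat_mode_line_derive m z v a c.
have d2 (c : R) := heat_mode_line_derive m z v (a * heat_symbol m v) c.
have pos (c : R) : `|c| <= `|t| -> 0 <= (z + c *: v).1.
  move=> ct; rewrite fstZ.
  have h : `|c * v.1| <= z.1.
    by rewrite normrM; apply: le_trans tz; rewrite ler_wpM2r.
  by move: h; rewrite ler_norml => /andP[h _]; lra.
have bd2 (c : R) : `|c| <= `|t| ->
    `|complex.Re (a * heat_symbol m v * heat_symbol m v * heat_mode m (z + c *: v))|
     <= 2 * norm1 (a * heat_symbol m v * heat_symbol m v).
  move=> ct; apply: le_trans (Re_le_norm1 _) _.
  exact: (norm1_heat_term (fun=> a * heat_symbol m v * heat_symbol m v) m (pos c ct)).
have bd1 (c : R) : `|c - 0| <= `|t| ->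
   `|complex.Re (a * heat_symbol m v * heat_mode m (z + c *: v)) -
     complex.Re (a * heat_symbol m v * heat_mode m (z + 0 *: v))|
    <= 2 * norm1 (a * heat_symbol m v * heat_symbol m v) * `|t|.
  rewrite subr0 => ct.
  have := @mvt_bound R _ _ 0 c (2 * norm1 (a * heat_symbol m v * heat_symbol m v)) d2.
  rewrite add0r => H; apply: le_trans (H _) _.
    by move=> c'; rewrite subr0 => c'c; apply: bd2; exact: le_trans ct.
  by rewrite ler_wpM2l // mulr_ge0 // norm1_ge0.
have := mvt_taylor d1 bd1.
by rewrite add0r z0.
Qed.

(** The Taylor remainders of the terms are at most [t^2] times a summable family,
    so the remainder of the sum is [O(t^2)] as well. *)
Lemma heat_series_derive_Re c z v : rapidC c -> 0 < z.1 ->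
  is_derive z v (fun z => complex.Re (heat_series c z))
    (complex.Re (heat_series (fun m => c m * heat_symbol m v) z)).
Proof.
move=> rc z0.
have rc2 := rapidC_mul_symbol v (rapidC_mul_symbol v rc).
have [_ [B BP]] := rapidC_dominating (ler0n R 2) rc2.
have B0 : 0 <= B by have := BP fset0; rewrite big_seq_fset0.
apply: is_derive_eps => e e0.
have v10 : 0 < `|v.1| + 1 by rewrite ltr_pwDr.
exists (Num.min (e / (B + 1)) (z.1 / (`|v.1| + 1))).
  by rewrite lt_min !divr_gt0 // ltr_pwDr.
move=> t; rewrite lt_min => /andP[t1 t2].
have tz : `|t| * `|v.1| <= z.1.
  move: t2; rewrite ltr_pdivlMr // => t2.
  have := normr_ge0 t; have := normr_ge0 v.1; nra.
have zt0 : 0 <= (z + t *: v).1.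
  rewrite fstZ; move: tz; rewrite -normrM ler_norml => /andP[h _]; lra.
have [h1 _] := heat_series_has_csum rc zt0.
have [h2 _] := heat_series_has_csum rc (ltW z0).
have [h3 _] := heat_series_has_csum (rapidC_mul_symbol v rc) (ltW z0).
have H := has_rsumD h1 (has_rsumD (has_rsumZ (k := -1) h2) (has_rsumZ (k := - t) h3)).
apply: (@le_trans _ _ (B * (`|t| * `|t|))); last first.
  rewrite mulrA ler_wpM2r //; move: t1; rewrite ltr_pdivlMr ?ltr_pwDr // => t1.
  by have := normr_ge0 t; nra.
have -> : complex.Re (heat_series c (z + t *: v)) - complex.Re (heat_series c z) -
   t * complex.Re (heat_series (fun m => c m * heat_symbol m v) z) =
   complex.Re (heat_series c (z + t *: v)) + (-1 * complex.Re (heat_series c z) +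
   - t * complex.Re (heat_series (fun m => c m * heat_symbol m v) z)) by ring.
apply: (@has_rsum_le _ _ _ (fun m =>
  2 * norm1 (c m * heat_symbol m v * heat_symbol m v) * (`|t| * `|t|)) _ _ _ _ H).
  move=> m; have T := heat_mode_taylor m (c m) tz.
  rewrite [2 * _ * (_ * _)]mulrA; apply: (le_trans _ T).
  by rewrite le_eqVlt; apply/orP; left; apply/eqP; congr `|_|; ring.
by move=> A; rewrite -big_distrl /= ler_wpM2r // mulr_ge0.
Qed.

Lemma rapidCZ c (a : R[i]) : rapidC c -> rapidC (fun m => a * c m).
Proof.
move=> rc; apply: le_rapid (rapidZ (norm1 a) rc) => m.
by rewrite normrM !ger0_norm ?norm1_ge0 // norm1M.
Qed.

(** [Im z = Re (- i z)], and the factor [- i] can be moved into the coefficients. *)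
Lemma heat_series_derive_Im c z v : rapidC c -> 0 < z.1 ->
  is_derive z v (fun z => complex.Im (heat_series c z))
    (complex.Im (heat_series (fun m => c m * heat_symbol m v) z)).
Proof.
move=> rc z0.
pose a : R[i] := 0 +i* (-1).
have ImE (x : R[i]) : complex.Im x = complex.Re (a * x) by rewrite ReM /=; ring.
have E d y : rapidC d -> 0 <= y.1 ->
    complex.Im (heat_series d y) = complex.Re (heat_series (fun m => a * d m) y).
  move=> rd y0; rewrite ImE; congr complex.Re.
  have := has_csumZ a (heat_series_has_csum rd y0).
  have -> : (fun m => a * (d m * heat_mode m y)) = (fun m => a * d m * heat_mode m y).
    by apply/funext => m; rewrite mulrA.
  by move/has_csum_unique; apply; apply: heat_series_has_csum => //; exact: rapidCZ.
have := heat_series_derive_Re v (rapidCZ a rc) z0.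
move=> H; apply: (@near_eq_is_derive _ _ _
  (fun z => complex.Re (heat_series (fun m => a * c m) z))).
  by apply: filterS (pos_near z0) => y y0; rewrite E // ltW.
rewrite (E _ _ (rapidC_mul_symbol v rc) (ltW z0)).
apply: is_derive_eq H _; congr (complex.Re (csum _)).
by apply/funext => m; rewrite !mulrA.
Qed.

Lemma interior_half_space z : interior half_space z <-> 0 < z.1.
Proof.
split; last first.
  by move=> z0; apply: filterS (pos_near z0) => y; exact: ltW.
move=> [[P Q] /= [nP nQ] PQ].
have /nbhs_ballP[r /= r0 rP] := nP.
suff : half_space (z.1 - r / 2, z.2) by rewrite /half_space /=; lra.
apply: PQ; split => /=; last exact: nbhs_singleton.
apply: rP; rewrite /ball /= opprB addrC subrK gtr0_norm; lra.
Qed.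

Definition heat_symbols c (vs : seq (R * 'rV[R]_n)) : 'rV[int]_n -> R[i] :=
  foldr (fun v d => fun m => d m * heat_symbol m v) c vs.

Lemma rapidC_symbols c vs : rapidC c -> rapidC (heat_symbols c vs).
Proof. by move=> rc; elim: vs => [//|v vs IH] /=; exact: rapidC_mul_symbol. Qed.

Lemma iter_derive_heat_series c vs : rapidC c -> forall z, 0 < z.1 ->
  iter_derive vs (fun y => complex.Re (heat_series c y)) z
    = complex.Re (heat_series (heat_symbols c vs) z) /\
  iter_derive vs (fun y => complex.Im (heat_series c y)) z
    = complex.Im (heat_series (heat_symbols c vs) z).
Proof.
move=> rc; elim: vs => [//|v vs IH] z z0 /=.
have rs := rapidC_symbols vs rc.
split.
  rewrite (near_eq_derive (g := fun y => complex.Re (heat_series (heat_symbols c vs) y))).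
    by have [_ ->] := heat_series_derive_Re v rs z0.
  by apply: filterS (pos_near z0) => y y0; have [] := IH y y0.
rewrite (near_eq_derive (g := fun y => complex.Im (heat_series (heat_symbols c vs) y))).
  by have [_ ->] := heat_series_derive_Im v rs z0.
by apply: filterS (pos_near z0) => y y0; have [] := IH y y0.
Qed.

Lemma heat_series_smooth c : rapidC c -> csmooth_on half_space (heat_series c).
Proof.
move=> rc; split; split; try by case: (heat_series_continuous rc).
  move=> vs; have rs := rapidC_symbols vs rc; split.
    move=> z v /interior_half_space z0.
    apply: (@near_eq_derivable _ _ _
      (fun y => complex.Re (heat_series (heat_symbols c vs) y))).
      by apply: filterS (pos_near z0) => y y0; have [] := iter_derive_heat_series vs rc y0.
    by have [] := heat_series_derive_Re v rs z0.
  exists (fun y => complex.Re (heat_series (heat_symbols c vs) y)).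
  split; first by case: (heat_series_continuous rs).
  by move=> z /interior_half_space z0; have [] := iter_derive_heat_series vs rc z0.
move=> vs; have rs := rapidC_symbols vs rc; split.
  move=> z v /interior_half_space z0.
  apply: (@near_eq_derivable _ _ _
      (fun y => complex.Im (heat_series (heat_symbols c vs) y))).
    by apply: filterS (pos_near z0) => y y0; have [] := iter_derive_heat_series vs rc y0.
  by have [] := heat_series_derive_Im v rs z0.
exists (fun y => complex.Im (heat_series (heat_symbols c vs) y)).
split; first by case: (heat_series_continuous rs).
by move=> z /interior_half_space z0; have [] := iter_derive_heat_series vs rc z0.
Qed.

Lemma cderive_heat_series c v z : rapidC c -> 0 < z.1 ->
  cderive v (heat_series c) z = heat_series (fun m => c m * heat_symbol m v) z.
Proof.
move=> rc z0; apply: complexP; rewrite /cderive /=.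
  by have [_ ->] := heat_series_derive_Re v rc z0.
by have [_ ->] := heat_series_derive_Im v rc z0.
Qed.

Lemma near_cderive (G H : R * 'rV[R]_n -> R[i]) v z :
  (\forall y \near z, G y = H y) -> cderive v G z = cderive v H z.
Proof.
move=> GH; rewrite /cderive; congr (_ +i* _); apply: near_eq_derive;
by apply: filterS GH => y ->.
Qed.

Lemma has_csum_sum (J : Type) (r : seq J) (a : J -> 'rV[int]_n -> R[i]) (S : J -> R[i]) :
  (forall j, has_csum (a j) (S j)) ->
  has_csum (fun m => \sum_(j <- r) a j m) (\sum_(j <- r) S j).
Proof.
move=> aS; elim: r => [|j r IH].
  have -> : (fun m : 'rV[int]_n => \sum_(j <- [::]) a j m) = (fun=> 0).
    by apply/funext => m; rewrite big_nil.
  by rewrite big_nil; split; apply/has_rsumP => e e0; exists fset0 => A _;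
    rewrite big1 // subrr normr0 ltW.
have -> : (fun m : 'rV[int]_n => \sum_(i <- j :: r) a i m) =
   (fun m => a j m + \sum_(i <- r) a i m).
  by apply/funext => m; rewrite big_cons.
by rewrite big_cons; exact: has_csumD.
Qed.

(** The symbol of the time derivative is [k] times the sum of the squares of the
    symbols of the partial derivatives. *)
Lemma heat_series_equation c (k : R) z : rapidC c -> k * w ^+ 2 = kap -> 0 < z.1 ->
  cderive time_dir (heat_series c) z = k%:C * laplacian_x (heat_series c) z.
Proof.
move=> rc kw z0; rewrite cderive_heat_series //.
have lapE : laplacian_x (heat_series c) z =
    \sum_(i < n) heat_series (fun m =>
      c m * heat_symbol m (space_dir i) * heat_symbol m (space_dir i)) z.
  apply: eq_bigr => i _.
  rewrite -cderive_heat_series //; last exact: rapidC_mul_symbol.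
  apply: near_cderive; apply: filterS (pos_near z0) => y y0.
  by rewrite cderive_heat_series.
rewrite lapE.
have H (i : 'I_n) := heat_series_has_csum
  (rapidC_mul_symbol (space_dir i) (rapidC_mul_symbol (space_dir i) rc)) (ltW z0).
have := has_csumZ k%:C (has_csum_sum (index_enum 'I_n) H).
have := heat_series_has_csum (rapidC_mul_symbol time_dir rc) (ltW z0).
move=> h1 h2; apply: (has_csum_unique h1).
congr (has_csum _ _): h2; apply/funext => m.
rewrite -big_distrl /= mulrA; congr (_ * _).
have dE (i : 'I_n) : dot (zvec m) (delta_mx 0 i : 'rV[R]_n) = (m 0 i)%:~R.
  by rewrite dot_delta mxE.
have symE (i : 'I_n) : heat_symbol m (space_dir i) * heat_symbol m (space_dir i) =
   (- (w ^+ 2 * ((m 0 i)%:~R * (m 0 i)%:~R)))%:C.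
  by apply: complexP; rewrite ?ReM ?ImM /heat_symbol /= dE; ring.
under eq_bigr => i _ do rewrite -mulrA symE.
rewrite -big_distrr /= mulrCA; congr (_ * _).
apply: complexP; rewrite ?ReM ?ImM Re_sum Im_sum /heat_symbol /=; last first.
  by rewrite dot0r big1_eq !mulr0 mul0r addr0.
rewrite big1_eq mulr0 subr0 mulr1 -kw /sqn /dot.
rewrite sumrN mulrN -big_distrr /= mulrA; congr (- (_ * _)).
by apply: eq_bigr => i _; rewrite !mxE.
Qed.

Lemma heat_series_periodic c (s : R) i t x : 0 < s -> `|w| * s = pi *+ 2 ->
  heat_series c (t, x + s *: delta_mx 0 i) = heat_series c (t, x).
Proof.
move=> s0 ws; congr csum; apply/funext => m; congr (_ * (_ * _)); rewrite /=.
rewrite dotD dot_delta mxE mulrDr cisD.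
have -> : w * (s * (m 0 i)%:~R) = (m 0 i)%:~R * (w * s) by ring.
by rewrite cis_freq_int // mulr1.
Qed.

End HeatModes.

Lemma continuous_setT (T U : topologicalType) (f : T -> U) :
  {within setT, continuous f} -> continuous f.
Proof.
move=> cf x A nA.
have H : nbhs x (fun y => setT y -> A (f y)).
  exact: (iffLR (subspace_continuousP _ _) cf x I A nA).
by apply: filterS H => y; apply.
Qed.

(** * Fourier coefficients of smooth functions and inversion *)

Section SumIntegralExchange.
Context {R : realType} {n : nat}.
Variables (s : R) (s0 : 0 < s).

Lemma cube_int_sum (J : Type) (r : seq J) (a : J -> 'rV[R]_n -> R) :
  (forall j, continuous (a j)) ->
  cube_int s (fun x => \sum_(j <- r) a j x) = \sum_(j <- r) cube_int s (a j).
Proof.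
move=> ca; have s0' := ltW s0; elim: r => [|j r IH].
  rewrite big_nil -[RHS](mul0r (s ^+ n)) -cube_int_cst //.
  by apply: cube_int_ext => x _; rewrite big_nil.
rewrite big_cons -IH -cube_intD //; last exact: sumf_continuous.
by apply: cube_int_ext => x _; rewrite big_cons.
Qed.

Lemma cube_int_exchange (I : choiceType) (b : I -> R) (a : I -> 'rV[R]_n -> R)
    (f : 'rV[R]_n -> R) : dominating b -> (forall i, continuous (a i)) ->
  (forall i x, box s x -> `|a i x| <= b i) ->
  continuous f -> (forall x, box s x -> has_rsum (fun i => a i x) (f x)) ->
  has_rsum (fun i => cube_int s (a i)) (cube_int s f).
Proof.
move=> db ca ab cf af; apply/has_rsumP => e e0.
have k0 : 0 < s ^+ n + 1 by rewrite ltr_wpDl ?exprn_ge0 // ltW.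
have [A0 A0P] := dominated_uniform db (divr_gt0 e0 k0).
exists A0 => A A0A.
have cs := sumf_continuous (r := enum_fset A) ca.
have s0' := ltW s0.
rewrite -cube_int_sum // -cube_intB //.
apply: (@le_trans _ _ (s ^+ n * (e / (s ^+ n + 1)))).
  apply: cube_int_bound; [exact: ltW|exact: subf_continuous|].
  by move=> x xb; apply: (A0P _ _ (fun i => ab i x xb) (af x xb)).
rewrite mulrCA ger_pMr // ler_pdivrMr //; lra.
Qed.

Lemma ccube_int_exchange (b : 'rV[int]_n -> R) (u : 'rV[int]_n -> 'rV[R]_n -> R[i])
    (S : 'rV[R]_n -> R[i]) : dominating b -> (forall m, ccontinuous (u m)) ->
  (forall m x, box s x -> norm1 (u m x) <= b m) ->
  ccontinuous S -> (forall x, box s x -> has_csum (fun m => u m x) (S x)) ->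
  has_csum (fun m => ccube_int s (u m)) (ccube_int s S).
Proof.
move=> db cu ub [cS1 cS2] uS; split.
  apply: (cube_int_exchange db) => //.
  - by move=> m; case: (cu m).
  - by move=> m x xb; apply: le_trans (Re_le_norm1 _) (ub m x xb).
  - by move=> x /uS [].
apply: (cube_int_exchange db) => //.
- by move=> m; case: (cu m).
- by move=> m x xb; apply: le_trans (Im_le_norm1 _) (ub m x xb).
- by move=> x /uS [].
Qed.

Lemma box_bounded (f : 'rV[R]_n -> R) : continuous f ->
  exists M, forall x, box s x -> `|f x| <= M.
Proof.
move=> cf.
have cabs : continuous (fun y => `|f y|).
  by move=> y; apply: continuous_comp; [exact: cf|exact: norm_continuous].
have box0 : @box R s n !=set0.
  by exists 0 => i; rewrite mxE normr0 divr_ge0 // ltW.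
have [z _ zH] := EVT_max_rV box0 (@box_compact R s n) (continuous_subspaceT cabs).
by exists `|f z| => x xb; apply: zH; rewrite inE.
Qed.

Lemma cbox_bounded (g : 'rV[R]_n -> R[i]) : ccontinuous g ->
  exists M, forall x, box s x -> norm1 (g x) <= M.
Proof.
move=> [/box_bounded[A AP] /box_bounded[B BP]].
by exists (A + B) => x xb; rewrite lerD ?AP ?BP.
Qed.

End SumIntegralExchange.

Section FourierCoefficients.
Context {R : realType} {n : nat}.
Variables (s w : R) (s0 : 0 < s) (ws : `|w| * s = pi *+ 2).
Implicit Types (g h : 'rV[R]_n -> R[i]) (m : 'rV[int]_n) (i : 'I_n).

Definition fourier_int g m : R[i] :=
  ccube_int s (fun x => g x * cis (- w * dot (zvec m) x)).

Definition is_cderive i g dg : Prop := forall x,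
  is_derive x (delta_mx 0 i) (fun y => complex.Re (g y)) (complex.Re (dg x)) /\
  is_derive x (delta_mx 0 i) (fun y => complex.Im (g y)) (complex.Im (dg x)).

Definition cube_periodic g : Prop := forall i x, g (x + s *: delta_mx 0 i) = g x.

Lemma is_cderiveM i g dg h dh : is_cderive i g dg -> is_cderive i h dh ->
  is_cderive i (fun x => g x * h x) (fun x => dg x * h x + g x * dh x).
Proof.
move=> Dg Dh x; have [g1 g2] := Dg x; have [h1 h2] := Dh x.
split.
  have -> : (fun y => complex.Re (g y * h y)) =
     (fun y => complex.Re (g y) * complex.Re (h y) - complex.Im (g y) * complex.Im (h y)) by apply/funext => y; rewrite ReM.
  apply: is_derive_eq; rewrite ReD !ReM /GRing.scale /=; ring.
have -> : (fun y => complex.Im (g y * h y)) =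
   (fun y => complex.Re (g y) * complex.Im (h y) + complex.Im (g y) * complex.Re (h y)) by apply/funext => y; rewrite ImM.
apply: is_derive_eq; rewrite ImD !ImM /GRing.scale /=; ring.
Qed.

Lemma is_cderive_wave i (e : R) (v : 'rV[R]_n) :
  is_cderive i (fun x => cis (e * dot v x))
    (fun x => (0 +i* (e * v 0 i)) * cis (e * dot v x)).
Proof.
move=> x; pose P := e * dot v x; pose Q := e * v 0 i.
have E t : e * dot v (x + t *: delta_mx 0 i) = P + t * Q.
  by rewrite dotD dot_delta /P /Q; ring.
have dP := is_derive_affine P Q 0.
split; rewrite ?ReM ?ImM /= -/P -/Q.
  have dc : is_derive (0 : R) (1 : R) (fun t : R => cos (P + t * Q))
      (- sin (P + 0 * Q) * Q).
    exact: (is_derive1_comp (is_derive_cos _) dP).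
  have H : is_derive x (delta_mx 0 i) (fun y => cos (e * dot v y)) (- sin (P + 0 * Q) * Q).
    by apply: is_derive_transfer dc => t; rewrite E add0r [t *: 1]mulr1.
  by apply: is_derive_eq H _; rewrite mul0r addr0; ring.
have dc : is_derive (0 : R) (1 : R) (fun t : R => sin (P + t * Q)) (cos (P + 0 * Q) * Q).
  exact: (is_derive1_comp (is_derive_sin _) dP).
have H : is_derive x (delta_mx 0 i) (fun y => sin (e * dot v y)) (cos (P + 0 * Q) * Q).
  by apply: is_derive_transfer dc => t; rewrite E add0r [t *: 1]mulr1.
by apply: is_derive_eq H _; rewrite mul0r addr0; ring.
Qed.

Lemma wave_periodic m i x :
  cis (- w * dot (zvec m) (x + s *: delta_mx 0 i)) = cis (- w * dot (zvec m) x).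
Proof.
rewrite dotD dot_delta mulrDr cisD mxE.
have -> : - w * (s * (m 0 i)%:~R) = (m 0 i)%:~R * (- w * s) by ring.
by rewrite (cis_freq_int s0) ?mulr1 // normrN.
Qed.

(** Integration by parts against the wave, whose derivative is a multiple of
    itself. *)
Lemma fourier_int_derive i g dg m : ccontinuous g -> ccontinuous dg -> is_cderive i g dg ->
  cube_periodic g -> fourier_int dg m = (0 +i* (w * (m 0 i)%:~R)) * fourier_int g m.
Proof.
move=> cg cdg Dg pg; rewrite /fourier_int.
have s0' := ltW s0.
pose E x := cis (- w * dot (zvec m) x) : R[i].
have cE : ccontinuous E by exact: wave_ccontinuous.
pose k : R[i] := 0 +i* (- w * (zvec m : 'rV[R]_n) 0 i).
have DE := is_cderiveM Dg (is_cderive_wave i (- w) (zvec m)).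
have pE x : g (x + s *: delta_mx 0 i) * E (x + s *: delta_mx 0 i) = g x * E x.
  by rewrite pg /E wave_periodic.
have cgE := ccontinuousM cg cE.
have cdh : ccontinuous (fun x => dg x * E x + g x * (k * E x)).
  apply: ccontinuousD; first exact: ccontinuousM.
  by apply: ccontinuousM => //; apply: ccontinuousM => //; exact: ccontinuous_cst.
have zero : ccube_int s (fun x => dg x * E x + g x * (k * E x)) = 0.
  apply: complexP; rewrite /ccube_int /=.
    apply: (cube_int_deriv0 s0 (i := i) (h := fun x => complex.Re (g x * E x))).
    - by case: cgE.
    - by case: cdh.
    - by move=> x; have [] := DE x.
    - by move=> x; rewrite pE.
  apply: (cube_int_deriv0 s0 (i := i) (h := fun x => complex.Im (g x * E x))).
  - by case: cgE.
  - by case: cdh.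
  - by move=> x; have [] := DE x.
  - by move=> x; rewrite pE.
have kE : 0 +i* (w * (m 0 i)%:~R) = - k.
  by rewrite /k mxE; apply: complexP; rewrite /= ?oppr0 //; ring.
rewrite kE mulrC -ccube_intZ //.
apply/eqP; rewrite -subr_eq0 -ccube_intB //; last 2 first.
- exact: ccontinuousM.
- by apply: ccontinuousM => //; exact: ccontinuous_cst.
rewrite -[X in _ == X]zero; apply/eqP; apply: ccube_int_ext => x _.
by rewrite -/(E x); ring.
Qed.

Lemma norm1_imM (y : R) (z : R[i]) : norm1 ((0 +i* y) * z) = `|y| * norm1 z.
Proof.
by rewrite /norm1 ReM ImM /= !mul0r sub0r add0r normrN !normrM -mulrDr addrC.
Qed.

Lemma fourier_int_bound g : ccontinuous g ->
  exists C, forall m, norm1 (fourier_int g m) <= C.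
Proof.
move=> cg; have [M MP] := cbox_bounded s0 cg.
exists (2 * (s ^+ n * (M * 2))) => m.
apply: ccube_int_bound; [exact: ltW|apply: ccontinuousM => //; exact: wave_ccontinuous|].
move=> x xb; apply: le_trans (norm1M _ _) _.
by apply: ler_pM; rewrite ?norm1_ge0 ?norm1_cis ?MP.
Qed.

Definition coord_dirs (vs : seq 'I_n) : seq 'rV[R]_n := [seq delta_mx 0 i | i <- vs].

Definition iter_partial g (vs : seq 'I_n) (x : 'rV[R]_n) : R[i] :=
  iter_derive (coord_dirs vs) (fun y => complex.Re (g y)) x +i*
  iter_derive (coord_dirs vs) (fun y => complex.Im (g y)) x.

Lemma smooth_setT (u : 'rV[R]_n -> R) : smooth_on setT u -> forall vs,
  continuous (iter_derive vs u) /\ forall x v, derivable (iter_derive vs u) x v.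
Proof.
move=> [_ H] vs; have [d [h [ch hE]]] := H vs.
rewrite interiorT in d hE.
split; last by move=> x v; exact: d.
have -> : iter_derive vs u = h by apply/funext => x; rewrite hE.
exact: continuous_setT.
Qed.

Lemma iter_partial_periodic g vs : cube_periodic g -> cube_periodic (iter_partial g vs).
Proof.
move=> pg i x; rewrite /iter_partial.
have per (u : 'rV[R]_n -> R) : (forall x, u (x + s *: delta_mx 0 i) = u x) ->
    forall vs x, iter_derive vs u (x + s *: delta_mx 0 i) = iter_derive vs u x.
  move=> pu; elim=> [//|v r IH] y /=.
  set f := iter_derive r u in IH *.
  have E : (fun t : R => t^-1 *: ((f \o shift (y + s *: delta_mx 0 i)) (t *: v) -
      f (y + s *: delta_mx 0 i))) = (fun t => t^-1 *: ((f \o shift y) (t *: v) - f y)).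
    by apply/funext => t /=; rewrite IH addrA IH.
  by rewrite /derive E.
by congr (_ +i* _); apply: per => y; rewrite pg.
Qed.

(** The Fourier integrals of the iterated partial derivatives are bounded, and
    by [fourier_int_derive] they are those of [g] times a monomial in the frequency. *)
Lemma fourier_int_rapid g : csmooth_on setT g -> cube_periodic g -> rapidC (fourier_int g).
Proof.
move=> [/smooth_setT sR /smooth_setT sI] pg.
have w0 : 0 < `|w| by rewrite normr_gt0 (freq_neq0 ws).
have cc vs : ccontinuous (iter_partial g vs).
  by split; [have [] := sR (coord_dirs vs)|have [] := sI (coord_dirs vs)].
have der i vs : is_cderive i (iter_partial g vs) (iter_partial g (i :: vs)).
  move=> x; have [_ d1] := sR (coord_dirs vs); have [_ d2] := sI (coord_dirs vs).
  by split; split.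
have intE vs m : norm1 (fourier_int (iter_partial g vs) m) =
    \prod_(i <- vs) (`|w| * `|(m 0 i)%:~R|) * norm1 (fourier_int g m).
  elim: vs => [|i vs IH].
    rewrite big_nil mul1r; congr (norm1 (fourier_int _ m)).
    by apply/funext => x; apply: complexP.
  rewrite (fourier_int_derive m (cc vs) (cc (i :: vs)) (der i vs)
    (iter_partial_periodic vs pg)).
  by rewrite norm1_imM IH big_cons normrM mulrA.
move=> vs; have [C CP] := fourier_int_bound (cc vs).
exists (C / `|w| ^+ size vs) => m.
rewrite ler_pdivlMr ?exprn_gt0 //; apply: le_trans (CP m).
rewrite intE ger0_norm ?norm1_ge0 // le_eqVlt; apply/orP; left; apply/eqP.
rewrite [RHS]mulrC -mulrA; congr (_ * _).
elim: vs {C CP} => [|i vs IH]; first by rewrite !big_nil mulr1.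
by rewrite !big_cons -IH /= exprS; ring.
Qed.

Lemma smooth_ccontinuous g : csmooth_on setT g -> ccontinuous g.
Proof. by move=> [[c1 _] [c2 _]]; split; exact: continuous_setT. Qed.

Lemma heat_series_slice (kap : R) (c : 'rV[int]_n -> R[i]) (t : R) : 0 < kap ->
  rapidC c -> 0 <= t -> ccontinuous (fun x => heat_series kap w c (t, x)).
Proof.
move=> kap0 rc t0.
have [] := @series_ccontinuous_within R 'rV[R]_n n setT
  (fun m x => c m * heat_mode kap w m (t, x)) _ (rapidC_dominating (ler0n R 2) rc).
- move=> m; apply: ccontinuousM; first exact: ccontinuous_cst.
  apply: (ccontinuous_comp (f := fun x => (t, x))); last exact: heat_mode_ccontinuous.
  exact: pair_continuousr.
- by move=> m x _; exact: (@norm1_heat_term R n kap w kap0 c m (t, x) t0).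
by move=> c1 c2; split; exact: continuous_setT.
Qed.

(** The derivative of the constant function 1 is zero, so by
    [fourier_int_derive] its Fourier integral at [m] is annihilated by each coordinate
    of [m]. *)
Lemma fourier_int1 m : fourier_int (fun=> 1) m = if m == 0 then (s ^+ n)%:C else 0.
Proof.
have s0' := ltW s0.
have [->|m0] := eqVneq m 0.
  rewrite /fourier_int (ccube_int_ext (h' := fun=> 1)); last first.
    move=> x _; rewrite mul1r.
    by rewrite (_ : dot _ _ = 0) ?mulr0 ?cis0 // /dot big1 // => i _; rewrite !mxE mul0r.
  by apply: complexP; rewrite /ccube_int /= cube_int_cst // ?mul1r ?mul0r.
have [i mi] : exists i, m 0 i != 0.
  apply/existsP; apply: contraNT m0; rewrite negb_exists => /forallP h.
  by apply/eqP/rowP => i; rewrite mxE; apply/eqP; have := h i; rewrite negbK.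
have c1 := @ccontinuous_cst R 'rV[R]_n 1.
have c0 := @ccontinuous_cst R 'rV[R]_n 0.
have D : is_cderive i (fun=> 1) (fun=> 0).
  by move=> x; split; exact: is_derive_cst.
have := fourier_int_derive m c1 c0 D (fun _ _ => erefl).
have -> : fourier_int (fun=> 0) m = 0.
  rewrite /fourier_int (ccube_int_ext (h' := fun=> 0)); last by move=> x _; rewrite mul0r.
  by apply: complexP; rewrite /ccube_int /= cube_int_cst // mul0r.
move=> /esym/(congr1 norm1); rewrite norm1_imM [norm1 0]/norm1 /= normr0 addr0.
have w0 : w != 0 := freq_neq0 ws.
move/eqP; rewrite mulf_eq0 normr_eq0 mulf_eq0 (negbTE w0) intr_eq0 (negbTE mi) /=.
rewrite /norm1 paddr_eq0 // !normr_eq0 => /andP[/eqP h1 /eqP h2].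
exact: complexP.
Qed.

Lemma has_csum_single (m0 : 'rV[int]_n) (z : R[i]) :
  has_csum (fun m => if m == m0 then z else 0) z.
Proof.
have E (A : {fset 'rV[int]_n}) : ([fset m0] `<=` A)%fset ->
    \sum_(m <- A) (if m == m0 then z else 0) = z.
  rewrite fsub1set => mA; rewrite (big_fsetD1 _ mA) /= eqxx big_seq big1 ?addr0 // => m.
  by rewrite !inE => /andP[/negbTE ->].
split; apply/has_rsumP => e e0; exists [fset m0]%fset => A /E h.
  by rewrite -(Re_sum (enum_fset A)) h subrr normr0 ltW.
by rewrite -(Im_sum (enum_fset A)) h subrr normr0 ltW.
Qed.

Definition fourier_coef g m : R[i] := ((s ^+ n)^-1)%:C * fourier_int g m.

Lemma fourier_coef_rapid g : csmooth_on setT g -> cube_periodic g ->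
  rapidC (fourier_coef g).
Proof. by move=> sg pg; apply: rapidCZ; exact: fourier_int_rapid. Qed.

(** With [M] a bound of [h] on the cube, the family [2 M (norm1 (c m))] dominates
    the integrands at every point. *)
Lemma heat_series_exchange (h : 'rV[R]_n -> R[i]) (c : 'rV[int]_n -> R[i])
    (phi : 'rV[R]_n -> 'rV[R]_n) (kap : R) :
  0 < kap -> rapidC c -> ccontinuous h -> continuous phi ->
  has_csum (fun m => ccube_int s (fun y => h y * (c m * heat_mode kap w m (0, phi y))))
           (ccube_int s (fun y => h y * heat_series kap w c (0, phi y))).
Proof.
move=> kap0 rc ch cphi.
have [M MP] := cbox_bounded s0 ch.
have M0 : 0 <= M.
  apply: le_trans (norm1_ge0 (h 0)) (MP 0 _) => i.
  by rewrite mxE normr0 divr_ge0 // ltW.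
apply: (ccube_int_exchange s0 (b := fun m => M * 2 * norm1 (c m))).
- by apply: rapidC_dominating => //; rewrite mulr_ge0.
- move=> m; apply: ccontinuousM => //; apply: ccontinuousM; first exact: ccontinuous_cst.
  apply: (ccontinuous_comp cphi (h := fun y => heat_mode kap w m (0, y))).
  apply: (ccontinuous_comp (f := fun x => (0, x))); last exact: heat_mode_ccontinuous.
  exact: pair_continuousr.
- move=> m y yb; apply: le_trans (norm1M _ _) _; rewrite -mulrA.
  apply: ler_pM; rewrite ?norm1_ge0 ?MP //.
  exact: (@norm1_heat_term R n kap w kap0 c m (0, phi y) (lexx 0)).
- apply: ccontinuousM => //.
  apply: (ccontinuous_comp cphi (h := fun y => heat_series kap w c (0, y))).
  exact: heat_series_slice.
- move=> y _; apply: has_csumZ.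
  exact: (@heat_series_has_csum R n kap w kap0 c (0, phi y) rc (lexx 0)).
Qed.

Lemma heat_mode0 kap m (x : 'rV[R]_n) : heat_mode kap w m (0, x) = cis (w * dot (zvec m) x).
Proof. by rewrite /heat_mode /= mulr0 oppr0 expR0 mul1r. Qed.

Lemma dot_zvecB m m' (x : 'rV[R]_n) :
  dot (zvec (m' - m)) x = dot (zvec m') x - dot (zvec m) x.
Proof.
rewrite /dot -sumrB; apply: eq_bigr => i _.
by rewrite !mxE intrB mulrBl.
Qed.

(** Term-by-term integration and the orthogonality of the waves show that the
    series has the same Fourier integrals as [g]; conclude by [fourier_unique]. *)
Lemma fourier_inversion (kap : R) g x : 0 < kap -> csmooth_on setT g -> cube_periodic g ->
  box s x -> heat_series kap w (fourier_coef g) (0, x) = g x.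
Proof.
move=> kap0 sg pg xb; have s0' := ltW s0.
have cg := smooth_ccontinuous sg.
have rc := fourier_coef_rapid sg pg.
have cS := heat_series_slice kap0 rc (lexx 0).
apply/eqP; rewrite -subr_eq0; apply/eqP.
apply: (fourier_unique s0 ws (ccontinuousB cS cg)) xb => m'.
have cE : ccontinuous (fun x => cis (- w * dot (zvec m') x)) by exact: wave_ccontinuous.
have -> : ccube_int s (fun x => (heat_series kap w (fourier_coef g) (0, x) - g x) *
    cis (- w * dot (zvec m') x)) =
  ccube_int s (fun y => cis (- w * dot (zvec m') y) *
    heat_series kap w (fourier_coef g) (0, y)) - fourier_int g m'.
  rewrite /fourier_int -ccube_intB //; last 2 first.
  - exact: ccontinuousM.
  - exact: ccontinuousM.
  by apply: ccube_int_ext => y _; ring.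
apply/eqP; rewrite subr_eq0; apply/eqP.
have H := heat_series_exchange kap0 rc cE (phi := id) (fun y => @cvg_id _ _).
apply: (has_csum_unique H).
have E : (fun m => ccube_int s (fun y => cis (- w * dot (zvec m') y) *
    (fourier_coef g m * heat_mode kap w m (0, id y)))) =
    (fun m => if m == m' then fourier_int g m' else 0).
  apply/funext => m.
  transitivity (fourier_int (fun=> 1) (m' - m) * fourier_coef g m).
    rewrite /fourier_int -ccube_intZ //; last first.
      by apply: ccontinuousM; [exact: ccontinuous_cst|exact: wave_ccontinuous].
    apply: ccube_int_ext => y _; rewrite heat_mode0 /= dot_zvecB mul1r.
    rewrite mulrCA mulrC -cisD; congr (cis _ * _); ring.
  rewrite fourier_int1 subr_eq0 eq_sym; case: eqP => [->|_]; last by rewrite mul0r.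
  rewrite /fourier_coef mulrA -rmorphM /= divff ?mul1r // expf_neq0 // gt_eqF //.
by rewrite E; exact: has_csum_single.
Qed.

End FourierCoefficients.

(** * The maximum principle *)

Section SecondDerivativeTest.
Context {R : realType}.

Lemma is_derive_near (V : normedModType R) (f : V -> R) x v d : is_derive x v f d ->
  forall e, 0 < e -> exists2 r, 0 < r & forall t, 0 < `|t| -> `|t| < r ->
     `|f (x + t *: v) - f x - t * d| <= e * `|t|.
Proof.
move=> [fd <-] e e0.
have : (fun t : R => t^-1 *: ((f \o shift x) (t *: v) - f x)) @ 0^' --> 'D_v f x.
  exact: fd.
move=> /cvgrPdistC_le /(_ e e0).
rewrite near_withinE => /nbhs_ballP[r /= r0 rH]; exists r => // t t0 tr.
have tn0 : t != 0 by rewrite -normr_gt0.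
have := rH t; rewrite /ball /= sub0r normrN => /(_ tr tn0).
rewrite [_ + x]addrC => h.
have -> : f (x + t *: v) - f x - t * 'D_v f x =
   t * (t^-1 * (f (x + t *: v) - f x) - 'D_v f x) by rewrite mulrBr mulVKf.
by rewrite normrM mulrC ler_wpM2r.
Qed.

(** The even part [phi c + phi (- c)] has derivative 0 at 0 whether or not 0 is
    critical for [phi]; if [d2 > 0] its derivative is positive for small [c > 0], and it
    would exceed its value at 0. *)
Lemma second_derivative_le0 (phi dphi : R -> R) (d2 r : R) : 0 < r ->
  (forall h, is_derive h (1 : R) phi (dphi h)) ->
  is_derive (0 : R) (1 : R) dphi d2 ->
  (forall h, `|h| <= r -> phi h <= phi 0) -> d2 <= 0.
Proof.
move=> r0 dP d2P maxP; rewrite leNgt; apply/negP => d20.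
have [r1 r10 r1H] := is_derive_near d2P (divr_gt0 d20 (ltr0Sn R 1)).
pose h := Num.min r (r1 / 2).
have h0 : 0 < h by rewrite lt_min r0 divr_gt0.
have hr : h <= r by rewrite ge_min lexx.
have hr1 : h < r1.
  have h2 : h <= r1 / 2 by rewrite ge_min lexx orbT.
  by lra.
have dneg c : is_derive c (1 : R) (fun c => phi (- c)) (- dphi (- c)).
  have dn : is_derive c (1 : R) (fun c : R => - c) (- 1).
    by apply: is_derive_eq.
  by apply: is_derive_eq (is_derive1_comp (dP (- c)) dn) _; rewrite mulrN1.
have dpsi c : is_derive c (1 : R) (fun c => phi c + phi (- c)) (dphi c - dphi (- c)).
  exact: is_deriveD.
have cpsi : continuous (fun c => phi c + phi (- c)).
  move=> c; apply: differentiable_continuous; apply/derivable1_diffP.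
  by have [] := dpsi c.
have [c] := MVT h0 (fun c _ => dpsi c) (continuous_subspaceT cpsi).
rewrite in_itv /= => /andP[c0 ch] E.
have b1 : phi h <= phi 0 by apply: maxP; rewrite gtr0_norm.
have b2 : phi (- h) <= phi 0 by apply: maxP; rewrite normrN gtr0_norm.
have cE : `|c| = c by rewrite gtr0_norm.
have := r1H c; rewrite cE add0r [c *: 1]mulr1 => /(_ c0 (lt_trans ch hr1)).
have := r1H (- c); rewrite normrN cE add0r [(- c) *: 1]mulr1.
move=> /(_ c0 (lt_trans ch hr1)).
rewrite !ler_norml => /andP[_ A2] /andP[A1 _].
have : 0 < dphi c - dphi (- c).
  have : 0 < d2 * c by rewrite mulr_gt0.
  by nra.
move: E; rewrite subr0 oppr0 => E P.
have : 0 < (dphi c - dphi (- c)) * h by rewrite mulr_gt0.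
rewrite -E; lra.
Qed.

End SecondDerivativeTest.

Section MaximumPrinciple.
Context {R : realType} {n : nat}.
Variables (s k : R) (s0 : 0 < s) (k0 : 0 < k).
Implicit Types (u : R * 'rV[R]_n -> R).

(** A displacement by at most one period along an axis brings a point of the cube at
    most one period away, so that one shift by a period is enough to return. *)
Lemma box_shift (x : 'rV[R]_n) i h : box s x -> `|h| <= s ->
  exists e : R, [\/ e = 0, e = s | e = - s] /\ box s (x + (h + e) *: delta_mx 0 i).
Proof.
move=> xb; rewrite ler_norml => /andP[h1 h2]; have s0' := s0.
have := xb i; rewrite ler_norml => /andP[x1 x2].
have bx e : `|x 0 i + (h + e)| <= s / 2 -> box s (x + (h + e) *: delta_mx 0 i).
  move=> H j; rewrite mxlineE mxE eqxx /=.
  by case: eqP => [->|_]; rewrite ?mulr1 ?mulr0 ?addr0.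
have [xh|xh] := leP (x 0 i + h) (s / 2); last first.
  exists (- s); split; first by constructor 3.
  by apply: bx; rewrite ler_norml; apply/andP; split; lra.
have [hx|hx] := leP (- (s / 2)) (x 0 i + h).
  exists 0; split; first by constructor 1.
  by apply: bx; rewrite ler_norml addr0 xh hx.
exists s; split; first by constructor 2.
by apply: bx; rewrite ler_norml; apply/andP; split; lra.
Qed.

(** If [u] were positive somewhere, [u - e t] with a small [e > 0] would have a
    positive maximum over [[0, t1] x cube] at some point with [t0 > 0].  There the second
    partial derivatives are at most 0, whereas the time derivative is at least [e / 2]. *)
Lemma heat_max_principle u (ut : R * 'rV[R]_n -> R) (ux uxx : 'I_n -> R * 'rV[R]_n -> R) :
  {within half_space, continuous u} ->
  (forall t x i, 0 <= t -> u (t, x + s *: delta_mx 0 i) = u (t, x)) ->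
  (forall z : R * 'rV[R]_n, 0 < z.1 -> is_derive z time_dir u (ut z)) ->
  (forall i (z : R * 'rV[R]_n), 0 < z.1 -> is_derive z (space_dir i) u (ux i z)) ->
  (forall i (z : R * 'rV[R]_n), 0 < z.1 -> is_derive z (space_dir i) (ux i) (uxx i z)) ->
  (forall t x, 0 < t -> box s x -> ut (t, x) = k * \sum_i uxx i (t, x)) ->
  (forall x, box s x -> u (0, x) <= 0) ->
  forall t x, 0 <= t -> box s x -> u (t, x) <= 0.
Proof.
move=> cu per Dt Dx Dxx pde init t1 x1 t10 x1b.
rewrite leNgt; apply/negP => u1.
have {}t10 : 0 < t1.
  rewrite lt_neqAle t10 andbT; apply/eqP => t1E.
  by move: u1; rewrite -t1E ltNge init.
(* With this slope u - e t still equals half of u at (t1, x1). *)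
pose e := u (t1, x1) / (2 * t1).
have e0 : 0 < e by rewrite divr_gt0 // mulr_gt0.
pose v z := u z - e * z.1.
pose K : set (R * 'rV[R]_n) := `[0, t1]%classic `*` @box R s n.
have Kc : compact K by apply: compact_setX; [exact: segment_compact|exact: box_compact].
have Khalf : K `<=` half_space by move=> z [/=]; rewrite in_itv /= => /andP[].
have K1 : K (t1, x1) by split => //=; rewrite in_itv /= lexx ltW.
have cv : {within K, continuous v}.
  have cuK := continuous_subspaceW Khalf cu.
  have cl : continuous (fun z : R * 'rV[R]_n => e * z.1).
    by apply: mulf_continuous; [exact: cst_continuous|move=> z; exact: cvg_fst].
  have clK := continuous_subspaceT (A := K) cl.
  by move=> z; apply: cvgB; [exact: cuK|exact: clK].
have [[t0 x0] K0 max0] := compact_EVT_max (ex_intro _ _ K1) Kc cv.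
move: K0; rewrite inE => -[/=]; rewrite in_itv /= => /andP[t00 t0t1] x0b.
have v1 : 0 < v (t0, x0).
  apply: (@lt_le_trans _ _ (v (t1, x1))); last by apply: max0; rewrite inE.
  rewrite /v /= /e.
  have -> : u (t1, x1) / (2 * t1) * t1 = u (t1, x1) / 2 by field; rewrite gt_eqF.
  lra.
have {}t00 : 0 < t0.
  rewrite lt_neqAle t00 andbT; apply/eqP => t0E.
  move: v1; rewrite /v -t0E /= mulr0 subr0 ltNge.
  by rewrite init.
have uxx_le0 i : uxx i (t0, x0) <= 0.
  have lineE t : (t0, x0) + t *: space_dir i = (t0, x0 + t *: delta_mx 0 i).
    by congr (_, _); rewrite /= [t *: 0]mulr0 addr0.
  have pos t : 0 < ((t0, x0) + t *: space_dir i).1 by rewrite lineE.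
  apply: (@second_derivative_le0 R (fun t => u ((t0, x0) + t *: space_dir i))
     (fun t => ux i ((t0, x0) + t *: space_dir i)) _ s s0).
  - by move=> t; apply: is_derive_line; exact: Dx.
  - apply: is_derive_line; rewrite scale0r addr0; exact: Dxx.
  move=> h hs; rewrite !lineE scale0r addr0.
  have [c [cE cb]] := box_shift i x0b hs.
  have -> : u (t0, x0 + h *: delta_mx 0 i) = u (t0, x0 + (h + c) *: delta_mx 0 i).
    case: cE => ->; first by rewrite addr0.
      by rewrite scalerDl addrA per // ltW.
    by rewrite -[RHS](per _ _ i (ltW t00)) -addrA -scalerDl subrK.
  have := max0 (t0, x0 + (h + c) *: delta_mx 0 i); rewrite inE /v /= => M.
  suff : K (t0, x0 + (h + c) *: delta_mx 0 i) by move/M; rewrite lerD2r.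
  by split => //=; rewrite in_itv /= t0t1 ltW.
have ut_le0 : ut (t0, x0) <= 0.
  by rewrite pde // pmulr_rle0 //; apply: sumr_le0.
have [r r0 rH] := is_derive_near (Dt (t0, x0) t00) (divr_gt0 e0 (ltr0Sn R 1)).
pose h := Num.min t0 (r / 2).
have h0 : 0 < h by rewrite lt_min t00 divr_gt0.
have ht : h <= t0 by rewrite ge_min lexx.
have hr : h < r.
  have h2 : h <= r / 2 by rewrite ge_min lexx orbT.
  by lra.
have hn : `|- h| = h by rewrite normrN gtr0_norm.
have := rH (- h); rewrite hn => /(_ h0 hr).
have -> : (t0, x0) + - h *: time_dir = (t0 - h, x0).
  by congr (_, _); rewrite /= ?[- h *: 1]mulr1 ?scaler0 ?addr0.
have := max0 (t0 - h, x0); rewrite inE /v /= => M.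
have : K (t0 - h, x0).
  by split => //=; rewrite in_itv /=; apply/andP; split; lra.
move=> /M M1; rewrite ler_norml => /andP[A _].
have : 0 <= h * - ut (t0, x0) by rewrite mulr_ge0 ?oppr_ge0 // ltW.
have : 0 < h * e by rewrite mulr_gt0.
nra.
Qed.

Definition real_heat u : Prop :=
  [/\ smooth_on half_space u,
      forall t x i, 0 <= t -> u (t, x + s *: delta_mx 0 i) = u (t, x) &
      forall t x, 0 < t -> box s x ->
        'D_time_dir u (t, x) = k * \sum_i 'D_(space_dir i) ('D_(space_dir i) u) (t, x)].

Lemma real_heat_le u1 u2 : real_heat u1 -> real_heat u2 ->
  (forall x, box s x -> u1 (0, x) = u2 (0, x)) ->
  forall t x, 0 <= t -> box s x -> u1 (t, x) <= u2 (t, x).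
Proof.
move=> [[c1 S1] p1 e1] [[c2 S2] p2 e2] init t x t0 xb; rewrite -subr_le0.
have d1 vs z v : 0 < z.1 -> derivable (iter_derive vs u1) z v.
  by move=> z0; apply: (S1 vs).1; apply/interior_half_space.
have d2 vs z v : 0 < z.1 -> derivable (iter_derive vs u2) z v.
  by move=> z0; apply: (S2 vs).1; apply/interior_half_space.
apply: (@heat_max_principle (fun z => u1 z - u2 z)
  (fun z => 'D_time_dir u1 z - 'D_time_dir u2 z)
  (fun i z => 'D_(space_dir i) u1 z - 'D_(space_dir i) u2 z)
  (fun i z => 'D_(space_dir i) ('D_(space_dir i) u1) z -
              'D_(space_dir i) ('D_(space_dir i) u2) z)) => //.
- by move=> z; apply: cvgB; [exact: c1|exact: c2].
- by move=> t' x' i t'0; rewrite p1 // p2.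
- move=> z z0; apply: is_deriveB; split => //; [exact: (d1 [::])|exact: (d2 [::])].
- move=> i z z0; apply: is_deriveB; split => //; [exact: (d1 [::])|exact: (d2 [::])].
- move=> i z z0; apply: is_deriveB; split => //.
    exact: (d1 [:: space_dir i]).
  exact: (d2 [:: space_dir i]).
- by move=> t' x' t'0 x'b; rewrite e1 // e2 // sumrB mulrBr.
- by move=> x' x'b; rewrite init // subrr.
Qed.

Lemma real_heat_unique u1 u2 : real_heat u1 -> real_heat u2 ->
  (forall x, box s x -> u1 (0, x) = u2 (0, x)) ->
  forall t x, 0 <= t -> box s x -> u1 (t, x) = u2 (t, x).
Proof.
move=> h1 h2 init t x t0 xb; apply/eqP; rewrite eq_le.
by rewrite !real_heat_le // => y yb; rewrite init.
Qed.

End MaximumPrinciple.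

(** * The fractional heat equation *)

Section FractionalConstants.
Context {R : realType}.
Variable alpha : R.

(** Reduce modulo [pi] to [[0, pi)], where the sine vanishes only at 0. *)
Lemma sin_eq0_piZ (x : R) : sin x = 0 -> exists j : int, x = j%:~R * pi.
Proof.
move=> sx; pose j := Num.floor (x / pi).
have pi0 : 0 < pi :> R by exact: pi_gt0.
pose b := x - j%:~R * pi.
have b0 : 0 <= b by rewrite subr_ge0 -ler_pdivlMr // floor_le.
have bpi : b < pi.
  rewrite ltrBlDr -[X in X + _]mul1r -mulrDl -ltr_pdivrMr //.
  by have := floorD1_gt (x / pi); rewrite intrD addrC.
have sinj (y : R) (q : nat) : sin y = 0 -> sin (y + q%:R * pi) = 0.
  move=> sy; elim: q => [|q IH]; first by rewrite mul0r addr0.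
  by rewrite -natr1 mulrDl mul1r addrA sinDpi IH oppr0.
have sinjN (y : R) (q : nat) : sin y = 0 -> sin (y - q%:R * pi) = 0.
  move=> sy; rewrite -[RHS]oppr0 -(sinj (- y) q) ?sinN ?sy ?oppr0 //.
  by rewrite -sinN; congr sin; ring.
have sb : sin b = 0.
  rewrite /b; case: (j) => q; first exact: sinjN.
  by rewrite NegzE mulrNz mulNr opprK; exact: sinj.
exists j; apply/eqP; rewrite -subr_eq0 -/b.
apply/eqP/le_anti; rewrite b0 andbT leNgt; apply/negP => bp.
by have := sin_gt0_pi (x := b); rewrite bp bpi sb ltxx => /(_ isT).
Qed.

Hypothesis sin_neq0 : sin alpha != 0.

Lemma side_gt0 : 0 < side alpha. Proof. by rewrite normr_gt0. Qed.

Lemma csc_side : `|csc alpha| * side alpha = 1.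
Proof. by rewrite /csc /side normfV mulVf // normr_eq0. Qed.

Lemma cotN : cot (- alpha) = - cot alpha.
Proof. by rewrite /cot cosN sinN invrN mulrN. Qed.

Lemma cscN : csc (- alpha) = - csc alpha.
Proof. by rewrite /csc sinN invrN. Qed.

Lemma chirpN n (x : 'rV[R]_n) : chirp alpha x * chirp (- alpha) x = 1.
Proof. by rewrite /chirp cotN mulrN -cisD subrr cis0. Qed.

Lemma csc_cot : csc alpha ^+ 2 = 1 + cot alpha ^+ 2.
Proof.
have s2 : sin alpha ^+ 2 != 0 by rewrite expf_neq0.
rewrite /csc /cot exprVn expr_div_n -[X in X + _](divff s2) -mulrDl.
by rewrite addrC cos2Dsin2 mul1r.
Qed.

(** The two square roots are conjugate and [|1 - i cot alpha| = |csc alpha|]. *)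
Lemma ampN : amp alpha * amp (- alpha) = (`|csc alpha|)%:C.
Proof.
rewrite /amp cotN.
set c := cot alpha.
have r1 : Num.sqrt (1 ^+ 2 + c ^+ 2) = `|csc alpha| by rewrite expr1n -csc_cot sqrtr_sqr.
have c1 : 1 <= `|csc alpha|.
  by rewrite -r1 -[X in X <= _]sqrtr1 expr1n ler_wsqrtr // lerDl sqr_ge0.
rewrite /sqrtc !opprK sqrrN r1 oppr_eq0.
set P := Num.sqrt ((_ + 1) / _); set Q := Num.sqrt ((_ - 1) / _).
have P2 : P * P = (`|csc alpha| + 1) / 2.
  by rewrite -expr2 sqr_sqrtr // divr_ge0 // addr_ge0.
have Q2 : Q * Q = (`|csc alpha| - 1) / 2.
  by rewrite -expr2 sqr_sqrtr // divr_ge0 // subr_ge0.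
have [c0|c0] := eqVneq c 0.
  have csc1 : `|csc alpha| = 1 by rewrite -r1 c0 expr0n addr0 expr1n sqrtr1.
  have Q0 : Q = 0 by rewrite /Q csc1 subrr mul0r sqrtr0.
  apply: complexP; rewrite ?ReM ?ImM /= Q0 ?mulr0 ?mul0r ?subr0 ?addr0 // P2; lra.
have sg2 : Num.sg c * Num.sg c = 1 by rewrite -expr2 sqr_sg c0.
apply: complexP; rewrite ?ReM ?ImM /= sgrN.
  transitivity (P * P + Num.sg c * Num.sg c * (Q * Q)); first by ring.
  by rewrite sg2 P2 Q2; field.
by ring.
Qed.

End FractionalConstants.

Section HeatSolutions.
Context {R : realType} {n : nat}.

Lemma solution_real_heat (s k : R) (G : R * 'rV[R]_n -> R[i]) :
  (forall t x i, 0 <= t -> G (t, x + s *: delta_mx 0 i) = G (t, x)) ->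
  csmooth_on half_space G ->
  (forall t x, 0 < t -> box s x ->
     cderive time_dir G (t, x) = k%:C * laplacian_x G (t, x)) ->
  real_heat s k (fun z => complex.Re (G z)) /\ real_heat s k (fun z => complex.Im (G z)).
Proof.
move=> per [sR sI] pde; split; split => //.
- by move=> t x i t0; rewrite per.
- move=> t x t0 xb; have := congr1 (@complex.Re R) (pde t x t0 xb).
  by rewrite ReM /= mul0r subr0 /laplacian_x Re_sum.
- by move=> t x i t0; rewrite per.
- move=> t x t0 xb; have := congr1 (@complex.Im R) (pde t x t0 xb).
  by rewrite ImM /= mul0r addr0 /laplacian_x Im_sum.
Qed.

End HeatSolutions.

Theorem proposition6p2 (R : realType) (n : nat) (alpha k : R)
    (f : 'rV[R]_n -> R[i])
    (n_ge1 : (1 <= n)%N)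
    (alphaNpiZ : forall j : int, alpha <> j%:~R * pi)
    (k_gt0 : 0 < k)
    (fS : chirp_smooth alpha f) :
  exists F : 'rV[R]_n -> R -> R[i],
    [/\ heat_solution alpha k f F,
        forall F' : 'rV[R]_n -> R -> R[i], heat_solution alpha k f F' ->
          forall (x : 'rV[R]_n) (t : R), cube alpha x -> 0 <= t -> F' x t = F x t,
        forall (x : 'rV[R]_n) (t : R), cube alpha x -> 0 < t ->
          F x t = frac_conv alpha f (frac_heat_kernel alpha k t) x
      & forall (x : 'rV[R]_n) (t : R), cube alpha x -> 0 <= t ->
          has_csum (fun m => frac_fourier alpha f m * (heat_decay alpha k t m)%:C
                             * frac_kernel (- alpha) m x) (F x t)].
Proof.
have sin_neq0 : sin alpha != 0.
  by apply/eqP => /sin_eq0_piZ[j]; exact: alphaNpiZ.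
have [g [pg sg fg]] := fS.
pose s := side alpha; pose w := 2 * pi * csc alpha; pose kap := k * w ^+ 2.
have s0 : 0 < s := side_gt0 sin_neq0.
have cscs : `|csc alpha| * s = 1 := csc_side sin_neq0.
have ws : `|w| * s = pi *+ 2.
  rewrite /w normrM -mulrA cscs mulr1 ger0_norm ?mulr_ge0 ?pi_ge0 //.
  by rewrite mulrC mulr_natr.
have w0 : w != 0 := freq_neq0 ws.
have kap0 : 0 < kap by rewrite mulr_gt0 // lt_neqAle sqr_ge0 eq_sym expf_neq0.
have cg := smooth_ccontinuous sg.
have rc := fourier_coef_rapid s0 ws sg pg.
have decayE t m : heat_decay alpha k t m = expR (- (kap * sqn m * t)).
  rewrite /heat_decay /kap /w /sqn real_normK ?num_real //; congr (expR (- _)); ring.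
pose G := heat_series kap w (fourier_coef s w g).
pose F (x : 'rV[R]_n) t := chirp (- alpha) x * G (t, x).
have GF t x : chirp alpha x * F x t = G (t, x).
  by rewrite /F mulrA chirpN mul1r.
have chirpK (x : 'rV[R]_n) z : chirp (- alpha) x * (chirp alpha x * z) = z.
  by rewrite mulrA [chirp (- alpha) x * _]mulrC chirpN mul1r.
have G0 x : cube alpha x -> G (0, x) = g x.
  by move=> xb; apply: (fourier_inversion s0 ws).
have Gper t x i : G (t, x + s *: delta_mx 0 i) = G (t, x).
  exact: heat_series_periodic.
have Gsm := heat_series_smooth w kap0 rc.
have Gpde t x : 0 < t -> cube alpha x ->
    cderive time_dir G (t, x) = k%:C * laplacian_x G (t, x).
  by move=> t0 _; apply: heat_series_equation.
have scE : (s ^+ n)^-1 = `|csc alpha| ^+ n.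
  by rewrite -exprVn -[s^-1]mul1r -cscs mulfK // gt_eqF.
exists F; split.
- exists G; split => //.
  + move=> t t0; split; first by move=> i x; exact: Gper.
    by move=> x _; rewrite GF.
  + exact: (heat_series_continuous w kap0 rc).
  + by move=> x xb; rewrite /F G0 // fg.
- move=> F' [G' [lift' _ sm' pde' init']] x t xb t0.
  have Gper' t' y i : 0 <= t' -> G' (t', y + s *: delta_mx 0 i) = G' (t', y).
    by move=> t'0; have [p _] := lift' t' t'0; exact: p.
  have [hR hI] := solution_real_heat (fun t y i _ => Gper t y i) Gsm Gpde.
  have [hR' hI'] := solution_real_heat Gper' sm' pde'.
  have init y : cube alpha y -> G' (0, y) = G (0, y).
    move=> yb; have [_ /(_ y yb) ->] := lift' 0 (lexx 0).
    by rewrite init' // fg // mulrA chirpN mul1r G0.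
  have E : G' (t, x) = G (t, x).
    apply: complexP.
      by apply: (real_heat_unique s0 k_gt0 hR' hR) => // y yb; rewrite init.
    by apply: (real_heat_unique s0 k_gt0 hI' hI) => // y yb; rewrite init.
  have [_ /(_ x xb) E'] := lift' t t0.
  by rewrite /F -E E' chirpK.
- move=> x t xb t0.
  pose d (m : 'rV[int]_n) : R[i] := (heat_decay alpha k t m)%:C.
  have rd : rapidC d.
    have rg := @gauss_rapid R n (kap * t) (mulr_gt0 kap0 t0).
    apply: le_rapid rg => m; rewrite /d norm1_real normr_id decayE.
    rewrite le_eqVlt; apply/orP; left; apply/eqP.
    by congr `|expR (- _)|; rewrite /sqn; ring.
  have cphi : continuous (fun y : 'rV[R]_n => x - y).
    apply: row_continuous => i.
    have -> : (fun y : 'rV[R]_n => (x - y) 0 i) = (fun y => x 0 i - y 0 i).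
      by apply/funext => y; rewrite !mxE.
    by apply: subf_continuous; [exact: cst_continuous|exact: coord_continuous].
  have HE := heat_series_exchange w s0 kap0 rd cg cphi.
  have convE : frac_conv alpha f (frac_heat_kernel alpha k t) x =
     chirp (- alpha) x * ((`|csc alpha| ^+ n)%:C *
       ccube_int s (fun y => g y * heat_series kap w d (0, x - y))).
    rewrite /frac_conv mulrA [chirp _ _ * _%:C]mulrC; congr (_ * _).
    apply: ccube_int_ext => y yb; rewrite fg // mulrA chirpN mul1r; congr (_ * _).
    congr csum; apply/funext => m; rewrite heat_mode0; congr (_ * cis _).
    rewrite /w; have := dotD (zvec m) 0 (x - y) (csc alpha); rewrite add0r => ->.
    by rewrite dot0r add0r; ring.
  rewrite convE /F; congr (_ * _).
  have h1 := heat_series_has_csum w kap0 rc (z := (t, x)) (ltW t0).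
  have h2 := has_csumZ (`|csc alpha| ^+ n)%:C HE.
  apply: (has_csum_unique h1).
  congr (has_csum _ _): h2; apply/funext => m.
  have -> : ccube_int s (fun y => g y * (d m * heat_mode kap w m (0, x - y))) =
     fourier_int s w g m * (d m * cis (w * dot (zvec m) x)).
    rewrite -ccube_intZ ?ltW //; last by apply: ccontinuousM => //; exact: wave_ccontinuous.
    apply: ccube_int_ext => y _; rewrite heat_mode0.
    have -> : w * dot (zvec m) (x - y) = w * dot (zvec m) x + - w * dot (zvec m) y.
      by have := dotD (zvec m) x y (-1); rewrite scaleN1r => ->; ring.
    by rewrite cisD; ring.
  rewrite /fourier_coef /heat_mode /= /d decayE.
  by rewrite scE; ring.
move=> x t xb t0.
have h1 := has_csumZ (chirp (- alpha) x) (heat_series_has_csum w kap0 rc (z := (t, x)) t0).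
congr (has_csum _ _): h1; apply/funext => m.
have -> : frac_fourier alpha f m =
    fourier_int s w g m * (amp alpha ^+ n * chirp alpha (zvec m : 'rV[R]_n)).
  rewrite -ccube_intZ ?ltW //; last by apply: ccontinuousM => //; exact: wave_ccontinuous.
  apply: ccube_int_ext => y yb; rewrite fg // /frac_kernel.
  have -> : wave alpha m y = cis (- w * dot (zvec m) y).
    by rewrite /wave /w; congr cis; ring.
  rewrite -[RHS]mul1r -{1}(chirpN alpha y); ring.
have waveE : wave (- alpha) m x = cis (w * dot (zvec m) x).
  by rewrite /wave cscN /w; congr cis; ring.
rewrite /frac_kernel waveE decayE /fourier_coef scE /heat_mode /=.
have ampn : (`|csc alpha| ^+ n)%:C = amp alpha ^+ n * amp (- alpha) ^+ n.
  by rewrite rmorphXn /= -ampN // exprMn.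
rewrite ampn -[LHS]mul1r -{1}(chirpN alpha (zvec m : 'rV[R]_n)); ring.
Qed.
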